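(* Let $(\mathcal{U},G)$ be a (possibly infinite-dimensional) connected Riemannian manifold, $J:\mathcal{U}\times\Xi\to\mathbb{R}$, $j(u)=\mathbb{E}[J(u,\xi)]$, and suppose that Assumption (M), stated in the context, holds. Let $\{t_n\}$ be step-sizes with $t_n\ge 0$, $\sum_{n=1}^\infty t_n=\infty$, $\sum_{n=1}^\infty t_n^2<\infty$. Let $\{u_n\}$ be generated by the stochastic gradient method $$u_{n+1}=\exp_{u_n}\bigl(-t_n\nabla J(u_n,\xi_n)\bigr),\qquad n=1,2,\dots,\quad u_1\in\mathcal{U},$$ where at each step the sample $\xi_n\in\Xi$ of $\xi$ is generated independently of $\xi_1,\dots,\xi_{n-1}$. Suppose that $u_n$ is $\mathcal{F}_n$-measurable for all $n$, for a filtration $\{\mathcal{F}_n\}$, and that $\{u_n\}$ is almost surely contained in a bounded set $\mathcal{C}\subset\mathcal{U}$. On an open set $U\subset\mathcal{U}$ containing $\mathcal{C}$, assume that $j:U\to\mathbb{R}$ is $L$-Lipschitz continuously differentiable and bounded below. Suppose that $\nabla J(u,\xi)$ is a stochastic gradient of $j$ and that there exists a constant $M\ge 0$ such that $\mathbb{E}[\|\nabla J(u,\xi)\|^2]\le M$ for all $u$. Then: 1. Almost surely, the sequence $\{j(u_n)\}$ converges and $\liminf_{n\to\infty}\|\nabla j(u_n)\|=0$. 2. If additionally $f(u):=\|\nabla j(u)\|^2$ is $L_f$-Lipschitz continuously differentiable, then $\lim_{n\to\infty}\nabla j(u_n)=0$ almost surely (i.e. $\|\nabla j(u_n)\|\to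 0$). In particular, (strong) limit points of $\{u_n\}$ are stationary points of $j$.
   Context: $G=(G_u)_{u\in\mathcal{U}}$ is a smoothly varying family of inner products on the tangent spaces $T_u\mathcal{U}$ and $\|\cdot\|=\sqrt{G(\cdot,\cdot)}$. $(\Omega,\mathcal{F},\mathbb{P})$ is a probability space and $\xi:\Omega\to\Xi\subset\mathbb{R}^m$ a random vector; $\xi\in\Xi$ also denotes a realization, and each $\xi_n$ has the distribution of $\xi$. $J:\mathcal{U}\times\Xi\to\mathbb{R}$ is such that $\omega\mapsto J(u,\xi(\omega))$ is $\mathbb{P}$-integrable for all $u$. Gradient: $\nabla j(u)\in T_u\mathcal{U}$ is defined (if it exists) by $(j_* )_u w=G_u(\nabla j(u),w)$ for all $w\in T_u\mathcal{U}$, where $(j_* )_u w=\frac{d}{dt}j(c(t))|_{t=0}$ for a differentiable curve $c$ with $c(0)=u$, $\dot c(0)=w$. $\nabla J(u,\xi)$ denotes the gradient of $J_\xi:=J(\cdot,\xi)$ at $u$. Stochastic gradient: a $\mathbb{P}$-integrable function $\nabla J:\mathcal{U}\times\Xi\to T\mathcal{U}$ such that (1) for almost every $\xi\in\Xi$, $((J_\xi)_* )_u w=G_u(\nabla J(u,\xi),w)$ for all $w\in T_u\mathcal{U}$, and (2) $\mathbb{E}[\nabla J(u,\xi)]=\nabla j(u)$. $\exp_u$ is the Riemannian exponential map: $\exp_u(v)=\gamma(1)$ for the geodesic $\gamma$ with $\gamma(0)=u$, $\dot\gamma(0)=v$. The distance $d(u,\tilde u)$ is the infimum of lengths of piecewise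 smooth curves from $u$ to $\tilde u$. The injectivity radius at $u$ is $i_u=\sup\{r>0:\exp_u|_{B_r(0_u)}\text{ is a diffeomorphism}\}$, with $B_r(0_u)\subset T_u\mathcal{U}$ the ball of radius $r$ around the zero vector $0_u$, and $i(\mathcal{U})=\inf_{u\in\mathcal{U}}i_u$. Assumption (M): (i) for all $u\in\mathcal{U}$ and almost all $\xi\in\Xi$ the gradient $\nabla J(u,\xi)$ exists; (ii) the distance $d(\cdot,\cdot)$ is non-degenerate; (iii) $i(\mathcal{U})>0$; (iv) for all $u\in\mathcal{U}$ and $\tilde u\in B_{i_u}(0_u)$ (identified with its image under $\exp_u$), the minimizing geodesic between $u$ and $\tilde u$ is completely contained in $B_{i_u}(0_u)$ (under the same identification). Under (M), the geodesic between points $u,\tilde u$ with $d(u,\tilde u)\le i(\mathcal{U})$ is regarded as uniquely defined, and there is $v\in T_u\mathcal{U}$ with $\tilde u=\exp_u(v)$, written $v=\exp_u^{-1}(\tilde u)$, and $d(u,\tilde u)=\|v\|$. $L$-Lipschitz continuously differentiable: the gradient of $j$ exists everywhere (on the set considered) and there is $L>0$ such that for all $u,\tilde u$ (in the set considered) with $d(u,\tilde u)\le i(\mathcal{U})$, $\|P_{1,0}\nabla j(\tilde u)-\nabla j(u)\|\le L\,d(u,\tilde u)$, where $P_{1,0}:T_{\gamma(1)}\mathcal{U}\to T_{\gamma(0)}\mathcal{U}$ is parallel transport along the unique geodesic $\gamma$ with $\gamma(0)=u$, $\gamma(1)=\tilde u$. A filtration is an increasing sequence of sub-$\sigma$-algebras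 of $\mathcal{F}$. A stationary point of $j$ is a point $u$ with $\nabla j(u)=0$.
   Formalization: Added: a.s., for all large n the geodesic step from u_n to u_{n+1} stays in the open set U (the claim fails otherwise). Read: ξ_n is independent of F_n and earlier samples, ∇J is jointly measurable, and limit points are those in U. *)

(* Defs.v *)
From mathcomp Require Import all_boot all_order all_algebra.
From mathcomp Require Import all_classical all_reals all_analysis.

Set Implicit Arguments.
Unset Strict Implicit.
Unset Printing Implicit Defensive.

Import Order.TTheory GRing.Theory Num.Theory.
Import numFieldNormedType.Exports.
Local Open Scope classical_set_scope.
Local Open Scope ring_scope.

Section calculus.
Context {R : realType}.

Definition is_ddir (E F : tvsType R) (f : E -> F) (x v : E) (y : F) : Prop :=
  (fun h : R => h^-1 *: (f (x + h *: v) - f x)) @ (0 : R)^' --> y.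

(* The junk value 0 is taken when the directional derivative does not exist. *)
Definition ddir (E F : tvsType R) (f : E -> F) (x v : E) : F :=
  xget 0 [set y | is_ddir f x v y].

(* C^k maps on an open set A in the sense of Michal and Bastiani: f is
   C^(k+1) if it is continuous and (x, v) |-> df(x; v) exists and is C^k on
   A x E.  On Banach spaces C^oo agrees with the Frechet notion. *)
Fixpoint Ck (k : nat) (E F : tvsType R) (A : set E) (f : E -> F) : Prop :=
  (forall x, A x -> {for x, continuous f}) /\
  match k with
  | 0 => True
  | k'.+1 => exists df : E * E -> F,
      (forall x v, A x -> is_ddir f x v (df (x, v))) /\
      @Ck k' (E * E)%type F (A `*` setT) df
  end.

Definition smooth (E F : tvsType R) (A : set E) (f : E -> F) : Prop :=
  forall k, Ck k A f.

End calculus.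

Record chart (R : realType) (E : tvsType R) (U : topologicalType) := Chart {
  cdom : set U;
  cmap : U -> E;
  cinv : E -> U;
  cdom_open : open cdom;
  cimg_open : open (cmap @` cdom);
  cmapK : forall u, cdom u -> cinv (cmap u) = u;
  cmap_cont : forall u, cdom u -> {for u, continuous cmap};
  cinv_cont : forall u, cdom u -> {for cmap u, continuous cinv} }.

(* The atlas is the family of the preferred charts (chart_at u).  The tangent
   space at u is E, a tangent vector at u being identified with its coordinates
   in the chart chart_at u; cchange below gives its coordinates elsewhere. *)
Record manifold (R : realType) (E : tvsType R) (U : topologicalType) :=
  Manifold {
  chart_at : U -> chart E U;
  chart_atP : forall u, cdom (chart_at u) u;
  chart_compat : forall p q,
    smooth (cmap (chart_at p) @` (cdom (chart_at p) `&` cdom (chart_at q)))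
           (cmap (chart_at q) \o cinv (chart_at p));
  model_hausdorff : hausdorff_space E;
  manifold_hausdorff : hausdorff_space U }.

Definition cchange (R : realType) (E : tvsType R) (U : topologicalType)
    (p q : chart E U) (u : U) (v : E) : E :=
  ddir (cmap q \o cinv p) (cmap p u) v.

(* Coordinates, in the chart p, of a family of bilinear forms on the tangent
   spaces. *)
Definition gram (R : realType) (E : tvsType R) (U : topologicalType)
    (M : manifold E U) (G : U -> E -> E -> R) (p : chart E U)
    (x v w : E) : R :=
  let u := cinv p x in
  G u (cchange p (chart_at M u) u v) (cchange p (chart_at M u) u w).

(* The metric may be weak: G u is not required to induce the topology of E. *)
Record riemannian (R : realType) (E : tvsType R) (U : topologicalType) :=
  Riemannian {
  base :> manifold E U;
  G : U -> E -> E -> R;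
  G_linear : forall u (a : R) v v' w,
    G u (a *: v + v') w = a * G u v w + G u v' w;
  G_sym : forall u v w, G u v w = G u w v;
  G_pos : forall u v, v != 0 -> 0 < G u v v;
  G_smooth : forall p,
    smooth ((cmap (chart_at base p) @` cdom (chart_at base p))
              `*` setT `*` setT)
      (fun z : E * E * E =>
         gram base G (chart_at base p) z.1.1 z.1.2 z.2 : R^o) }.

Section riemannian_geometry.
Context {R : realType} {E : tvsType R} {U : topologicalType}.
Variable M : riemannian E U.

Definition tnorm (u : U) (v : E) : R := Num.sqrt (G M u v v).

Definition smooth_into (F : tvsType R) (A : set F) (f : F -> U) : Prop :=
  forall x, A x -> exists O : set F, [/\ open O, O x,
    (forall y, O y -> cdom (chart_at M (f x)) (f y)) &
    smooth O (cmap (chart_at M (f x)) \o f)].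

Definition smooth_from (W : set U) (f : U -> E) : Prop :=
  forall p, smooth (cmap (chart_at M p) @` (cdom (chart_at M p) `&` W))
                   (f \o cinv (chart_at M p)).

Definition is_velocity (c : R -> U) (t : R) (w : E) : Prop :=
  {for t, continuous c} /\
  is_ddir (cmap (chart_at M (c t)) \o c : R^o -> E) t 1 w.

Definition velocity (c : R -> U) (t : R) : E :=
  ddir (cmap (chart_at M (c t)) \o c : R^o -> E) t 1.

Definition is_gradient (h : U -> R) (u : U) (g : E) : Prop :=
  forall (c : R -> U) (w : E),
    (exists2 e : R, 0 < e &
       forall t, `|t| < e -> exists w', is_velocity c t w') ->
    c 0 = u -> is_velocity c 0 w ->
    is_derive (0 : R^o) (1 : R^o) (h \o c : R^o -> R^o) (G M u g w).

Definition has_gradient (h : U -> R) (u : U) : Prop :=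
  exists g, is_gradient h u g.

Definition grad (h : U -> R) (u : U) : E := xget 0 [set g | is_gradient h u g].

(* Smooth up to the end points of [0, 1]. *)
Definition smooth_curve01 (c : R -> U) : Prop :=
  exists O : set R^o, [/\ open O, `[0, 1]%classic `<=` O & smooth_into O c].

Definition clength (c : R -> U) : \bar R :=
  (\int[lebesgue_measure]_(t in `[0%R, 1%R]%classic)
     (tnorm (c t) (velocity c t))%:E)%E.

(* pw_curve u v l: some concatenation of finitely many smooth curves joins u
   to v and has length l. *)
Inductive pw_curve : U -> U -> \bar R -> Prop :=
| pw_nil u : pw_curve u u 0%E
| pw_cons (c : R -> U) (v : U) (l : \bar R) :
    smooth_curve01 c -> pw_curve (c 1) v l ->
    pw_curve (c 0) v (clength c + l)%E.

Definition dist (u v : U) : \bar R := ereal_inf [set l | pw_curve u v l].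

(* Levi-Civita connection in a chart, Christoffel symbols of the first kind:
   2 g(Gamma(a, b), z) = Dg[a](b, z) + Dg[b](a, z) - Dg[z](a, b). *)
Definition christoffel (p : chart E U) (x a b z : E) : R :=
  let g v w : E -> R^o := fun y => gram M (G M) p y v w in
  2^-1 * (ddir (g b z) x a + ddir (g a z) x b - ddir (g a b) x z).

(* W is the covariant derivative at t of the field V along c.  In the chart at
   c t it is V' + Gamma(c', V); testing against all z avoids assuming that
   Gamma, defined through a possibly weak metric, exists in E. *)
Definition is_covderiv (c : R -> U) (V : R -> E) (t : R) (W : E) : Prop :=
  let p := chart_at M (c t) in
  exists V' : E,
    is_ddir (fun s : R^o => cchange (chart_at M (c s)) p (c s) (V s)) t 1 V' /\
    forall z, G M (c t) W z =
      G M (c t) V' z + christoffel p (cmap p (c t)) (velocity c t) (V t) z.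

Definition geodesic (c : R -> U) : Prop :=
  exists O : set R^o, [/\ open O, `[0, 1]%classic `<=` O, smooth_into O c &
    forall t, O t -> is_covderiv c (velocity c) t 0].

(* X = P_{1,0} Y, for the parallel transport along c from c 1 to c 0. *)
Definition transport10 (c : R -> U) (Y X : E) : Prop :=
  exists V : R -> E, exists O : set R^o,
    [/\ open O, `[0, 1]%classic `<=` O,
      (forall t, O t -> is_covderiv c V t 0), V 1 = Y & V 0 = X].

Definition min_geodesic (c : R -> U) (u v : U) : Prop :=
  [/\ geodesic c, c 0 = u, c 1 = v & clength c = dist u v].

(* exp_u v = y, along a geodesic segment t |-> exp_u(t v) contained in A.  The exponential map
   is a relation since it need not be everywhere defined. *)
Definition exp_in (A : set U) (u : U) (v : E) (y : U) : Prop :=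
  exists c : R -> U, [/\ geodesic c, c 0 = u, velocity c 0 = v, c 1 = y &
    forall t, 0 <= t <= 1 -> A (c t)].

Definition is_exp : U -> E -> U -> Prop := exp_in setT.

Definition tball (u : U) (r : \bar R) : set E :=
  [set v | ((tnorm u v)%:E < r)%E].

Definition exp_diffeo (u : U) (r : R) : Prop :=
  exists (e : E -> U) (l : U -> E), let B := tball u r%:E in
    [/\ (forall v, B v -> forall y, is_exp u v y <-> y = e v),
        smooth_into B e, open (e @` B),
        (forall v, B v -> l (e v) = v) & smooth_from (e @` B) l].

Definition inj_radius_at (u : U) : \bar R :=
  ereal_sup [set r%:E | r in [set r : R | 0 < r /\ exp_diffeo u r]].

Definition inj_radius : \bar R := ereal_inf [set inj_radius_at u | u in setT].

Definition exp_ball (u : U) : set U :=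
  [set y | exists2 v, tball u (inj_radius_at u) v & is_exp u v y].

Definition bounded (C : set U) : Prop :=
  exists r : R, forall u v, C u -> C v -> (dist u v <= r%:E)%E.

(* At distance exactly i(U) several minimizing geodesics may exist, in which
   case the bound is required along each of them. *)
Definition lipschitz_diff (A : set U) (h : U -> R) (L : R) : Prop :=
  [/\ 0 < L, (forall u, A u -> has_gradient h u) &
    forall u v, A u -> A v -> (dist u v <= inj_radius)%E ->
    forall c, min_geodesic c u v ->
    exists2 X, transport10 c (grad h v) X &
      ((tnorm u (X - grad h u))%:E <= L%:E * dist u v)%E].

End riemannian_geometry.

Definition borel (T : topologicalType) : set (set T) := <<s [set O : set T | open O] >>.
Arguments borel : clear implicits.

Definition borel_prod (S T : topologicalType) : set (set (S * T)) :=
  <<s [set A `*` B | A in [set A : set S | open A]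
                   & B in [set B : set T | open B]] >>.
Arguments borel_prod : clear implicits.

(* Measurability of f : D -> R for the trace on D of the sigma-algebra S. *)
Definition measurable_on (R : realType) (T : Type) (S : set (set T))
    (D : set T) (f : T -> R) : Prop :=
  forall O : set R, open O -> exists2 B, S B & D `&` f @^-1` O = D `&` B.

Definition measurable_wrt (T : Type) (X : topologicalType) (S : set (set T))
    (f : T -> X) : Prop :=
  forall O : set X, open O -> S (f @^-1` O).

Definition sigma_of (T : Type) (X : topologicalType) (f : T -> X) :
    set (set T) := [set f @^-1` B | B in borel X].

Definition indep_sigma (d : measure_display) (T : measurableType d)
    (R : realType) (P : probability T R) (S1 S2 : set (set T)) : Prop :=
  forall A B, S1 A -> S2 B -> P (A `&` B) = (P A * P B)%E.

Definition filtration (d : measure_display) (T : measurableType d)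
    (F : nat -> set (set T)) : Prop :=
  [/\ forall n, sigma_algebra setT (F n), forall n, F n `<=` measurable
    & forall n, F n `<=` F n.+1].

(* Everything known before the n-th sample is drawn: the sigma-algebra
   generated by F_n and by the earlier samples. *)
Definition past (d : measure_display) (T : measurableType d)
    (X : topologicalType) (F : nat -> set (set T)) (x : nat -> T -> X)
    (n : nat) : set (set T) :=
  <<s F n `|` \bigcup_(k in [set k | (k < n)%N]) sigma_of (x k) >>.

Section stochastic.
Context {R : realType} {E : tvsType R} {U : topologicalType}.
Variable M : riemannian E U.
Context {d : measure_display} {Omega : measurableType d}.
Variable P : probability Omega R.
Context {m : nat}.
Variables (Xi : set 'rV[R]_m) (xi : Omega -> 'rV[R]_m).

Definition expected (J : U -> 'rV[R]_m -> R) (u : U) : R :=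
  fine ('E_P[fun w => J u (xi w)])%E.

(* Gradients of almost all J(., xi) exist, the distance is non-degenerate, the
   injectivity radius is positive, and minimizing geodesics from u to a point
   of the ball of radius i_u stay in that ball. *)
Definition assumptionM (J : U -> 'rV[R]_m -> R) : Prop :=
  [/\ forall u, {ae P, forall w, has_gradient M (J ^~ (xi w)) u},
      forall u v, dist M u v = 0%E -> u = v,
      (0 < inj_radius M)%E &
      forall u v c, exp_ball M u v -> min_geodesic M c u v ->
        forall t, 0 <= t <= 1 -> exp_ball M u (c t)].

(* Convention accompanying assumptionM: points at distance at most i(U)
   are joined by a geodesic exp_u(t v) whose length |v| is their distance. *)
Definition log_exists : Prop :=
  forall u y, (dist M u y <= inj_radius M)%E ->
    exists2 v, is_exp M u v y & (tnorm M u v)%:E = dist M u y.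

(* g is the expectation in (T_u U, G_u) of the random tangent vector Y: the
   weak integral, which determines g since G_u is definite. *)
Definition tangent_mean (u : U) (Y : Omega -> E) (g : E) : Prop :=
  forall w, P.-integrable setT (fun o => (G M u (Y o) w)%:E) /\
    (\int[P]_o (G M u (Y o) w)%:E)%E = (G M u g w)%:E.

(* Joint measurability of (u, x) |-> Y u x into the tangent bundle over A,
   tested on the norm and on the differentials dh of the differentiable
   functions h on A. *)
Definition measurable_field (A : set U) (Y : U -> 'rV[R]_m -> E) : Prop :=
  measurable_on (borel_prod U 'rV[R]_m) (A `*` Xi)
    (fun z => tnorm M z.1 (Y z.1 z.2)) /\
  forall h : U -> R, (forall u, A u -> has_gradient M h u) ->
    measurable_on (borel_prod U 'rV[R]_m) (A `*` Xi)
      (fun z => G M z.1 (grad M h z.1) (Y z.1 z.2)).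

Definition stochastic_gradient (A : set U) (J : U -> 'rV[R]_m -> R)
    (gJ : U -> 'rV[R]_m -> E) : Prop :=
  measurable_field A gJ /\
  forall u, A u ->
    [/\ P.-integrable setT (fun o => (tnorm M u (gJ u (xi o)))%:E),
        {ae P, forall o, is_gradient M (J ^~ (xi o)) u (gJ u (xi o))},
        has_gradient M (expected J) u &
        tangent_mean u (fun o => gJ u (xi o)) (grad M (expected J) u)].

End stochastic.

(* Main.v *)
Require Import Defs.
From HB Require Import structures.
From mathcomp Require Import all_boot all_order all_algebra.
From mathcomp Require Import all_classical all_reals all_analysis.
From mathcomp Require Import measurable_realfun.
From mathcomp Require Import ring lra.

(** The descent inequality along a geodesic follows from metric compatibility
of parallel transport.  A geodesic shorter than the injectivity radius is
minimizing, so that the Lipschitz condition on the gradient applies to it.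
With X_n the sampled gradient at u_n and g_n = |grad j(u_n)|, this gives
j(u_(n+1)) <= j(u_n) - t_n G(grad j(u_n), X_n) + L/2 t_n^2 |X_n|^2.  The
centered parts of G(grad j(u_n), X_n) and |X_n|, weighted by t_n, form
square-summable martingale differences, whose series converge almost surely by
Kolmogorov's maximal inequality; hence j(u_n) converges and
sum t_n g_n^2 < oo, and the liminf of g_n is 0.  Finally
|g_(n+1) - g_n| <= L t_n |X_n|, and over an excursion of g_n away from 0 the sum
of the t_n |X_n| is, up to a vanishing error, at most sqrt K times that of the
t_n, which sum t_n g_n^2 < oo makes small; so g_n converges to 0. *)

Set Implicit Arguments.
Unset Strict Implicit.
Unset Printing Implicit Defensive.

Import Order.TTheory GRing.Theory Num.Theory.
Import numFieldNormedType.Exports.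
Local Open Scope classical_set_scope.
Local Open Scope ring_scope.

(** * Calculus in topological vector spaces *)

Section directional_derivatives.
Context {R : realType}.

(** The model space [E] has no norm and the metric may be weak. The chain rule and the mean value
    theorem are therefore used for real-valued functions only: Gram forms, pairings with
    [G_u(., z)], and the objective along a curve. Randomness is confined to three series: those of
    the centered |X_n| and of the centered G(grad j(u_n), X_n), weighted by t_n, and that of (t_n
    |X_n|)^2. Once these converge, every further estimate concerns real sequences along one path.
    Convergence of the third series also makes the steps eventually shorter than the injectivity
    radius. No conditional expectation is formed. Independence says that w |-> (w, w) carries P to
    the product of its restrictions to the past and to the n-th sample; integrating over the second
    factor, with the past frozen, plays that role. Both centered families are square integrable
    because E|X|^2 <= K also forces |grad j|^2 <= K by Jensen. The same inequality bounds the mean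
    of |X| by sqrt K, the constant that appears for excursions. *)

Lemma tvs_cvgD (T : Type) (Fl : set_system T) {FF : Filter Fl} (E : tvsType R)
    (f g : T -> E) (a b : E) :
  f @ Fl --> a -> g @ Fl --> b -> (fun x => f x + g x) @ Fl --> a + b.
Proof.
move=> fa gb.
apply: (@cvg_comp _ _ _ (fun x => (f x, g x)) (fun z : E * E => z.1 + z.2)
  _ (nbhs (a, b))).
  exact: cvg_pair.
exact: (add_continuous (a, b)).
Qed.

Lemma tvs_cvgZ (T : Type) (Fl : set_system T) {FF : Filter Fl} (E : tvsType R)
    (k : T -> R) (f : T -> E) (l : R) (a : E) :
  k @ Fl --> l -> f @ Fl --> a -> (fun x => k x *: f x) @ Fl --> l *: a.
Proof.
move=> kl fa.
apply: (@cvg_comp _ _ _ (fun x => (k x, f x)) (fun z : R^o * E => z.1 *: z.2)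
  _ (nbhs ((l : R^o), a))).
  by apply: (@cvg_pair _ _ _ _ (nbhs (l : R^o))).
exact: (scale_continuous ((l : R^o), a)).
Qed.

Lemma is_ddir_unique (E F : tvsType R) (f : E -> F) x v y y' :
  hausdorff_space F -> is_ddir f x v y -> is_ddir f x v y' -> y = y'.
Proof. by move=> hF h1 h2; apply: (cvg_unique _ h1 h2). Qed.

Lemma ddirE (E F : tvsType R) (f : E -> F) x v y :
  hausdorff_space F -> is_ddir f x v y -> ddir f x v = y.
Proof.
move=> hF h; rewrite /ddir; case: xgetP => [z _ hz|/(_ y)//].
exact: is_ddir_unique hz h.
Qed.

Lemma is_ddir0 (E F : tvsType R) (f : E -> F) x : is_ddir f x 0 0.
Proof.
rewrite /is_ddir; under eq_fun do rewrite scaler0 addr0 subrr scaler0.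
exact: cvg_cst.
Qed.

Lemma is_ddirZ (E F : tvsType R) (f : E -> F) x v y (a : R) :
  is_ddir f x v y -> is_ddir f x (a *: v) (a *: y).
Proof.
have [-> _|a0 h] := eqVneq a 0; first by rewrite !scale0r; exact: is_ddir0.
rewrite /is_ddir.
have -> : (fun h : R => h^-1 *: (f (x + h *: (a *: v)) - f x)) =
  (fun h : R => a *: ((h * a)^-1 *: (f (x + (h * a) *: v) - f x))).
  apply/funext => k; rewrite !scalerA; congr (_ *: _).
  by rewrite invfM mulrCA mulfV // mulr1.
apply: tvs_cvgZ; first exact: cvg_cst.
apply: (@cvg_comp _ _ _ (fun k : R => k * a) _ _ _ _ _ h).
move=> A /= [e /= e0 eA]; exists (e / `|a|) => /=.
  by rewrite divr_gt0 // normr_gt0.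
move=> k /=; rewrite sub0r normrN => ke k0; apply: eA => /=.
  by rewrite sub0r normrN normrM -ltr_pdivlMr // normr_gt0.
by rewrite mulf_neq0.
Qed.

Lemma is_ddir_near (E F : tvsType R) (f g : E -> F) x v y :
  (\forall z \near x, f z = g z) -> is_ddir f x v y -> is_ddir g x v y.
Proof.
move=> fg; have fgx : f x = g x by exact: nbhs_singleton fg.
apply: cvg_trans; apply: near_eq_cvg.
have : (fun h : R => x + h *: v) @ (0 : R)^' --> x + 0 *: v.
  apply: tvs_cvgD; first exact: cvg_cst.
  apply: tvs_cvgZ; last exact: cvg_cst.
  exact: nbhs_dnbhs.
rewrite scale0r addr0 => /(_ _ fg) /= {fg}; rewrite near_simpl => fg.
by near=> h; rewrite fgx; congr (_ *: (_ - _)); near: h.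
Unshelve. all: end_near. Qed.

(** Link with one-variable derivatives, through which the mean value theorem enters. *)
Lemma is_ddirP (f : R^o -> R^o) (x y : R) :
  is_ddir f x 1 y <-> is_derive (x : R^o) (1 : R^o) f y.
Proof.
have e : (fun h : R => h^-1 *: (f (x + h *: (1 : R^o)) - f x)) =
         (fun h : R => h^-1 *: ((f \o shift (x : R^o)) (h *: (1 : R^o)) - f x)).
  by apply/funext => h /=; rewrite (addrC x).
split; rewrite /is_ddir e.
  move=> h; split; first by apply/cvg_ex; exists y.
  exact: cvg_lim h.
by case=> /cvg_ex[l hl] <-; rewrite /derive (cvg_lim _ hl).
Qed.

Lemma is_ddir_line (E F : tvsType R) (f : E -> F) (x v : E) (k : R) y :
  is_ddir f (x + k *: v) v y ->
  is_ddir (fun s : R^o => f (x + s *: v)) k 1 y.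
Proof.
apply: cvg_trans; apply: near_eq_cvg; near=> h; congr (_ *: (_ - _)).
by rewrite -addrA -scalerDl /GRing.scale /= mulr1.
Unshelve. all: end_near. Qed.

(** * Differentials of real-valued C^1 functions: additivity and chain rule *)

Section scalar_chain_rule.
Context (X : tvsType R) (A : set X) (f : X -> R^o) (df : X * X -> R^o).
Hypothesis fdf : forall x v, A x -> is_ddir f x v (df (x, v)).

(** On the segment [f] is a function of one real variable. The equality at an intermediate point,
    special to real values, replaces norm estimates on [X], which need not be normed. *)
Lemma segment_mvt x v : (forall k, 0 <= k <= 1 -> A (x + k *: v)) ->
  exists2 k, 0 <= k <= 1 & f (x + v) - f x = df (x + k *: v, v).
Proof.
move=> hA; pose g (s : R^o) : R^o := f (x + s *: v).
have dg k : 0 <= k <= 1 -> is_derive (k : R^o) (1 : R^o) g (df (x + k *: v, v)).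
  move=> k01; apply/is_ddirP/is_ddir_line; exact/fdf/hA.
have [||k] := @MVT_segment R g (fun k => df (x + k *: v, v)) 0 1 ler01.
- by move=> k; rewrite in_itv /= => /andP[k0 k1]; apply: dg; rewrite !ltW.
- apply: derivable_within_continuous => k; rewrite in_itv /= => k01.
  by have [] := dg k k01.
rewrite in_itv /= subr0 mulr1 => k01 gk; exists k => //.
by rewrite -gk /g scale1r scale0r addr0.
Qed.

Lemma differentialZ x v (a : R) : A x -> df (x, a *: v) = a * df (x, v).
Proof.
move=> Ax; apply: (@is_ddir_unique X R^o f x (a *: v)).
- exact: norm_hausdorff.
- exact: fdf.
- exact/is_ddirZ/fdf.
Qed.

Hypothesis A_open : open A.
Hypothesis df_cont : forall x v, A x -> {for (x, v), continuous df}.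

(** By [segment_mvt] the quotient is a value of [df] at an intermediate point, close to
    [df (x0, w0)] by joint continuity. Letting the base point move yields additivity of [df];
    letting the direction move yields the chain rule along curves. *)
Lemma strict_differential (y w : R -> X) (x0 w0 : X) : A x0 ->
  y @ (0 : R)^' --> x0 -> w @ (0 : R)^' --> w0 ->
  (fun h : R => h^-1 *: (f (y h + h *: w h) - f (y h))) @ (0 : R)^'
    --> df (x0, w0).
Proof.
move=> Ax0 yx ww N Nd.
(* The intermediate points are [y h + (k * h) *: w h] with [k] in [0, 1]. A neighbourhood of the
   scalar 0, which absorbs [k * h], controls all of them at once. *)
have : (fun q : R^o * X * X => (q.1.2 + q.1.1 *: q.2, q.2)) @
    (nbhs (((0 : R^o), x0), w0)) --> (x0, w0).
  apply: (@cvg_pair _ _ _ _ (nbhs x0)); last exact: cvg_snd.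
  suff: (fun q : R^o * X * X => q.1.2 + q.1.1 *: q.2) @
    (nbhs (((0 : R^o), x0), w0)) --> x0 + 0 *: w0 by rewrite scale0r addr0.
  apply: tvs_cvgD.
    by apply: cvg_comp; [exact: cvg_fst | exact: cvg_snd].
  apply: (@tvs_cvgZ _ _ _ X (fun q : R^o * X * X => q.1.1)); last exact: cvg_snd.
  by apply: cvg_comp; [exact: cvg_fst | exact: cvg_fst].
have AN : nbhs (x0, w0) (fun q => A q.1 /\ N (df q)).
  apply: filterI; last exact: (@df_cont x0 w0 Ax0).
  exists (A, setT); last by move=> ? [].
  by split => /=; [exact: open_nbhs_nbhs | exact: filterT].
move=> /(_ _ AN) [[B1 B3] /= [B1n B3n] B13].
case: B1n => -[B0 B2] /= [[e /= e0 B0e] B2n] B12.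
change (\forall h \near (0 : R)^', N (h^-1 *: (f (y h + h *: w h) - f (y h)))).
near=> h.
have h0 : h != 0 by near: h; exact: nbhs_dnbhs_neq.
have By : B2 (y h) by near: h; exact: yx.
have Bw : B3 (w h) by near: h; exact: ww.
have he : `|h| < e.
  near: h; apply: nbhs_dnbhs; exists e => //= k /=; by rewrite sub0r normrN.
have key k : 0 <= k <= 1 -> A (y h + k *: (h *: w h)) /\
    N (df (y h + k *: (h *: w h), w h)).
  move=> /andP[k0 k1]; rewrite scalerA.
  apply: (B13 (((k * h : R^o), y h), w h)); split => //=.
  apply: B12; split => //=; apply: B0e => /=.
  rewrite sub0r normrN normrM (ger0_norm k0); apply: le_lt_trans he.
  by rewrite ler_piMl.
have [k k01 /= ->] := @segment_mvt (y h) (h *: w h) (fun k hk => (key k hk).1).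
have [Ak Nk] := key k k01.
by rewrite differentialZ // /GRing.scale /= mulrA mulVf // mul1r.
Unshelve. all: end_near. Qed.

(** The increment along [h *: (a + b)] is cut at [x + h *: a]. One of the two pieces starts at a
    moving point, hence the use of [strict_differential]. *)
Lemma differentialD x a b : A x -> df (x, a + b) = df (x, a) + df (x, b).
Proof.
move=> Ax.
have c1 : (fun h : R => x + h *: a) @ (0 : R)^' --> x.
  rewrite -[X in _ --> X](addr0 x) -[X in x + X](scale0r a).
  apply: tvs_cvgD; first exact: cvg_cst.
  apply: tvs_cvgZ; last exact: cvg_cst.
  exact: nbhs_dnbhs.
have cb := strict_differential Ax c1 (@cvg_cst _ b _ _ (dnbhs_filter _)).
have := tvs_cvgD cb (@fdf x a Ax); rewrite /is_ddir.
have -> : (fun h : R => h^-1 *: (f (x + h *: a + h *: b) - f (x + h *: a)) +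
   h^-1 *: (f (x + h *: a) - f x)) =
   (fun h : R => h^-1 *: (f (x + h *: (a + b)) - f x)).
  by apply/funext => h; rewrite (scalerDr h a b) (addrA x) -scalerDr addrA subrK.
move=> /(_ _) h; rewrite [RHS]addrC; apply: (@is_ddir_unique X R^o f x (a + b)) _ h.
- exact: norm_hausdorff.
- exact: fdf.
Qed.

(** The moving direction is the difference quotient of [z], because [z (t + h)] is [z t] plus [h]
    times that quotient. *)
Lemma differential_curve (z : R -> X) (t : R) (w : X) : A (z t) ->
  is_ddir (z : R^o -> X) t 1 w -> is_ddir (f \o z : R^o -> R^o) t 1 (df (z t, w)).
Proof.
move=> Az zw; have := strict_differential Az (@cvg_cst _ (z t) _ _ (dnbhs_filter _)) zw.
apply: cvg_trans; apply: near_eq_cvg; near=> h; congr (_ *: (_ - _)).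
rewrite /= scalerA divff ?scale1r ?subrKC //.
by near: h; exact: nbhs_dnbhs_neq.
Unshelve. all: end_near. Qed.

End scalar_chain_rule.

(** The derivative of [f \o l] is that of [f] precomposed with [(x, v) |-> (l x, dl v)]. This map is
    again affine, with linear part [dl] on both components, so the induction applies to it. *)
Lemma Ck_affine (k : nat) (X Y F : tvsType R) (A : set Y) (f : Y -> F)
    (l : X -> Y) (dl : X -> Y) :
  (forall x v (h : R), l (x + h *: v) = l x + h *: dl v) ->
  continuous l -> continuous dl ->
  Ck k A f -> Ck k (l @^-1` A) (f \o l).
Proof.
elim: k X Y A f l dl => [|k IH] X Y A f l dl lE lc dlc [fc fk]; split.
- by move=> x Ax; apply: continuous_comp; [exact: lc | exact: fc].
- by [].
- by move=> x Ax; apply: continuous_comp; [exact: lc | exact: fc].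
case: fk => df [fdf dfk].
exists (df \o (fun q : X * X => (l q.1, dl q.2))); split.
  move=> x v Ax; rewrite /is_ddir /=; under eq_fun do rewrite lE.
  exact: fdf.
have -> : l @^-1` A `*` setT = (fun q : X * X => (l q.1, dl q.2)) @^-1` (A `*` setT).
  by [].
(* The linearity of [dl] that the induction needs is recovered from [lE], the only link between [l]
   and [dl]. *)
have dl0 : dl 0 = 0.
  by have := lE 0 0 1; rewrite !scale1r addr0 -{1}[l 0]addr0 => /addrI.
have dlE (x v : X) (h : R) : dl (x + h *: v) = dl x + h *: dl v.
  have l0 y : l y = l 0 + dl y.
    by rewrite -[in LHS](add0r y) -[in LHS](scale1r y) lE scale1r.
  by have := l0 (x + h *: v); rewrite lE l0 -addrA => /addrI.
apply: (IH _ _ _ _ _ (fun q : X * X => (dl q.1, dl q.2))) => //.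
- by move=> [x v] [x' v'] h /=; rewrite lE dlE.
- move=> [x v]; apply: (@cvg_pair _ _ _ _ (nbhs (l x)) (nbhs (dl v))).
    apply: continuous_comp; [exact: cvg_fst|exact: lc].
  apply: continuous_comp; [exact: cvg_snd|exact: dlc].
- move=> [x v]; apply: (@cvg_pair _ _ _ _ (nbhs (dl x)) (nbhs (dl v))).
    apply: continuous_comp; [exact: cvg_fst|exact: dlc].
  apply: continuous_comp; [exact: cvg_snd|exact: dlc].
Qed.

Lemma smooth_affine (X Y F : tvsType R) (A : set Y) (f : Y -> F)
    (l : X -> Y) (dl : X -> Y) :
  (forall x v (h : R), l (x + h *: v) = l x + h *: dl v) ->
  continuous l -> continuous dl ->
  smooth A f -> smooth (l @^-1` A) (f \o l).
Proof. by move=> *; move=> k; apply: Ck_affine; eauto. Qed.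

End directional_derivatives.

(** * Charts and the metric *)

Section smooth_maps.
Context {R : realType}.

Lemma smooth_continuous (X Y : tvsType R) (A : set X) (f : X -> Y) x :
  smooth A f -> A x -> {for x, continuous f}.
Proof. by move=> /(_ 0%N)[h _]; exact: h. Qed.

Lemma smooth_differential (X Y : tvsType R) (A : set X) (f : X -> Y) :
  smooth A f -> exists df : X * X -> Y,
    (forall x v, A x -> is_ddir f x v (df (x, v))) /\
    (forall x v, A x -> {for (x, v), continuous df}).
Proof.
move=> /(_ 1%N)[_ [df [fdf [dfc _]]]]; exists df; split => // x v Ax.
by apply: dfc.
Qed.

Lemma is_ddir_pair (X Y Z : tvsType R) (f : X -> Y) (g : X -> Z) x v a b :
  is_ddir f x v a -> is_ddir g x v b ->
  is_ddir (fun s => (f s, g s)) x v (a, b).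
Proof. by move=> fa gb; exact: (cvg_pair fa gb). Qed.

Lemma is_ddir_linear (X Y : tvsType R) (f : X -> Y) (l : Y -> R^o) x v a :
  (forall (k : R) y z, l (k *: y - k *: z) = k * (l y - l z)) -> {for a, continuous l} ->
  is_ddir f x v a -> is_ddir (l \o f : X -> R^o) x v (l a).
Proof.
move=> ll lc fa; rewrite /is_ddir.
have -> : (fun h : R => h^-1 *: ((l \o f) (x + h *: v) - (l \o f) x)) =
    l \o (fun h : R => h^-1 *: (f (x + h *: v) - f x)).
  by apply/funext => h /=; rewrite [in RHS]scalerBr ll.
exact: (@cvg_comp _ _ _ _ l _ _ _ fa lc).
Qed.

Lemma open_setX (S T : topologicalType) (A : set S) (B : set T) :
  open A -> open B -> open (A `*` B).
Proof.
rewrite !openE => oA oB [a b] [/= Aa Bb].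
by exists (A, B) => //; split; [exact: oA | exact: oB].
Qed.

End smooth_maps.

Section manifolds.
Context {R : realType} {E : tvsType R} {U : topologicalType}.
Variable M : riemannian E U.

Let hE : hausdorff_space E := model_hausdorff M.

Lemma is_ddir_id (x v : E) : is_ddir id x v v.
Proof.
rewrite /is_ddir; apply: cvg_near_cst; near=> h.
rewrite addrC addKr scalerA mulVf ?scale1r //.
by near: h; exact: nbhs_dnbhs_neq.
Unshelve. all: end_near. Qed.

Lemma open_cmap_image (p : chart E U) (W : set U) :
  open W -> open (cmap p @` (cdom p `&` W)).
Proof.
move=> oW; rewrite openE => _ [u [pu Wu] <-] /=.
have h1 : \forall y \near cmap p u, (cmap p @` cdom p) y.
  by apply: open_nbhs_nbhs; split; [exact: cimg_open | exists u].
have h2 : \forall y \near cmap p u, W (cinv p y).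
  apply: (cinv_cont pu); rewrite cmapK //.
  exact: open_nbhs_nbhs.
by apply: filterS2 h1 h2 => _ [v pv <-]; rewrite cmapK // => Wv; exists v.
Qed.

Lemma cchange_id (p : chart E U) (u : U) (v : E) : cdom p u -> cchange p p u v = v.
Proof.
move=> pu; apply: ddirE => //; apply: (@is_ddir_near _ _ _ id); last exact: is_ddir_id.
have : \forall y \near cmap p u, (cmap p @` cdom p) y.
  by apply: open_nbhs_nbhs; split; [exact: cimg_open | exists u].
by apply: filterS => _ [w pw <-] /=; rewrite cmapK.
Qed.

Lemma GZ u a v w : G M u (a *: v) w = a * G M u v w.
Proof.
by have := G_linear M u a v 0 w; rewrite addr0 => ->; rewrite -[RHS]addr0; congr +%R;
  have := G_linear M u (-1) 0 0 w; rewrite scaler0 add0r mulN1r => {1}->; rewrite addNr.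
Qed.

Lemma GD u v v' w : G M u (v + v') w = G M u v w + G M u v' w.
Proof. by have := G_linear M u 1 v v' w; rewrite scale1r mul1r. Qed.

Lemma G0 u w : G M u 0 w = 0.
Proof. by rewrite -(scale0r 0) GZ mul0r. Qed.

Lemma GN u v w : G M u (- v) w = - G M u v w.
Proof. by rewrite -scaleN1r GZ mulN1r. Qed.

Lemma GB u v v' w : G M u (v - v') w = G M u v w - G M u v' w.
Proof. by rewrite GD GN. Qed.

Lemma GZr u a v w : G M u v (a *: w) = a * G M u v w.
Proof. by rewrite G_sym GZ G_sym. Qed.

Lemma GDr u v w w' : G M u v (w + w') = G M u v w + G M u v w'.
Proof. by rewrite G_sym GD G_sym (G_sym _ _ w'). Qed.

Lemma GNr u v w : G M u v (- w) = - G M u v w.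
Proof. by rewrite G_sym GN G_sym. Qed.

Lemma GBr u v w w' : G M u v (w - w') = G M u v w - G M u v w'.
Proof. by rewrite GDr GNr. Qed.

Lemma G_ge0 u v : 0 <= G M u v v.
Proof.
by have [->|v0] := eqVneq v 0; [rewrite G0 | rewrite ltW // G_pos].
Qed.

Lemma G_eq0 u v : G M u v v = 0 -> v = 0.
Proof.
by move=> h; apply/eqP; apply: contraT => /(G_pos M u); rewrite h ltxx.
Qed.

Lemma G_weak_eq u v w : (forall z, G M u v z = G M u w z) -> v = w.
Proof.
move=> h; apply/eqP; rewrite -subr_eq0; apply/eqP/(@G_eq0 u).
by rewrite GB h subrr.
Qed.

Lemma gram_center u v w :
  gram M (G M) (chart_at M u) (cmap (chart_at M u) u) v w = G M u v w.
Proof.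
have pu := chart_atP M u.
by rewrite /gram cmapK // !cchange_id.
Qed.

Lemma gram_domP p u v w : cdom (chart_at M p) u ->
  {for ((cmap (chart_at M p) u, v), w), continuous (fun z : E * E * E =>
         gram M (G M) (chart_at M p) z.1.1 z.1.2 z.2 : R^o)}.
Proof.
move=> pu; apply: smooth_continuous (G_smooth M p) _.
by split => //; split => //; exists u.
Qed.

(** The Gram form is smooth, and at the centre of the chart of [u] it is [G_u] itself. Hence [G_u]
    is continuous for the topology of [E] even if it does not induce it, and limits in [E] may be
    tested against it. *)
Lemma G_continuous u : continuous (fun z : E * E => G M u z.1 z.2 : R^o).
Proof.
move=> [v w].
have -> : (fun z : E * E => G M u z.1 z.2 : R^o) =
    (fun z : E * E * E =>
         gram M (G M) (chart_at M u) z.1.1 z.1.2 z.2 : R^o) \o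
    (fun z : E * E => ((cmap (chart_at M u) u, z.1), z.2)).
  by apply/funext => z /=; rewrite gram_center.
apply: continuous_comp; last exact/gram_domP/chart_atP.
apply: (@cvg_pair _ _ _ _ (nbhs (cmap (chart_at M u) u, v)) (nbhs w)).
  apply: (@cvg_pair _ _ _ _ (nbhs (cmap (chart_at M u) u)) (nbhs v)).
    exact: cvg_cst.
  exact: cvg_fst.
exact: cvg_snd.
Qed.

Lemma G_continuousl u w : continuous (fun v : E => G M u v w : R^o).
Proof.
move=> v; apply: (@continuous_comp _ _ _ (fun v : E => (v, w))
  (fun z : E * E => G M u z.1 z.2 : R^o)).
  by apply: (@cvg_pair _ _ _ _ (nbhs v) (nbhs w)); [exact: cvg_id|exact: cvg_cst].
exact: G_continuous.
Qed.

Lemma is_ddir_cchange p q u v : cdom (chart_at M p) u -> cdom (chart_at M q) u ->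
  is_ddir (cmap (chart_at M q) \o cinv (chart_at M p)) (cmap (chart_at M p) u) v
    (cchange (chart_at M p) (chart_at M q) u v).
Proof.
move=> pu qu; have [df [h _]] := smooth_differential (chart_compat M p q).
have := h (cmap (chart_at M p) u) v; rewrite /cchange => {}h.
have {}h : is_ddir (cmap (chart_at M q) \o cinv (chart_at M p))
    (cmap (chart_at M p) u) v (df (cmap (chart_at M p) u, v)) by apply: h; exists u.
by rewrite (ddirE hE h).
Qed.

(* The chain rule for the transition maps is only needed tested against the
   functionals G_u(., z), which separate points because G_u is definite; this
   is why scalar calculus suffices, however weak the metric. *)
Lemma cchangeK p u a : cdom (chart_at M p) u ->
  cchange (chart_at M p) (chart_at M u) u
    (cchange (chart_at M u) (chart_at M p) u a) = a.
Proof.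
move=> pu; have uu := chart_atP M u.
set P := chart_at M p; set Q := chart_at M u.
set a' := cchange Q P u a.
apply: (@G_weak_eq u) => z.
have [df [fdf dfc]] := smooth_differential (chart_compat M p u).
pose l v : R^o := G M u v z.
have lin (k : R) (y z' : E) : l (k *: y - k *: z') = k * (l y - l z').
  by rewrite /l GB !GZ mulrBr.
pose A := cmap P @` (cdom P `&` cdom Q).
have oA : open A by apply: open_cmap_image; exact: cdom_open.
have Au : A (cmap P u) by exists u.
have lfd x v : A x -> is_ddir (l \o (cmap Q \o cinv P) : E -> R^o) x v ((l \o df) (x, v)).
  by move=> Ax; apply: is_ddir_linear => //; [exact: G_continuousl | exact: fdf].
have ldc x v : A x -> {for (x, v), continuous (l \o df)}.
  by move=> Ax; apply: continuous_comp; [exact: dfc | exact: G_continuousl].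
(* The straight line through [u] in direction [a], drawn in the chart of [u] and read in the chart
   of [p]. *)
pose c (h : R) := (cmap P \o cinv Q) (cmap Q u + h *: a).
have c0 : c 0 = cmap P u by rewrite /c scale0r addr0 /= cmapK.
have dc : is_ddir (c : R^o -> E) 0 1 a'.
  apply: (@is_ddir_line _ _ _ (cmap P \o cinv Q)).
  rewrite scale0r addr0; exact: is_ddir_cchange.
have := @differential_curve _ _ A _ _ lfd oA ldc c 0 a'.
rewrite c0 => /(_ Au dc) h1.
have h2 : is_ddir (l \o (cmap Q \o cinv P) \o c : R^o -> R^o) 0 1 (l a).
  apply: (@is_ddir_near _ _ _ (fun h : R^o => l (cmap Q u + h *: a))); last first.
    apply: (@is_ddir_line _ _ _ l); rewrite scale0r addr0.
    by apply: (@is_ddir_linear _ _ _ id) => //; [exact: G_continuousl | exact: is_ddir_id].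
  have : (fun h : R^o => cmap Q u + h *: a) @ (0 : R^o) --> cmap Q u + (0 : R) *: a.
    by apply: tvs_cvgD; [exact: cvg_cst | apply: tvs_cvgZ; [exact: cvg_id|exact: cvg_cst]].
  rewrite scale0r addr0 => hc.
  have oB : open (cmap Q @` (cdom Q `&` cdom P)) by apply: open_cmap_image; exact: cdom_open.
  have : \forall y \near cmap Q u, (cmap Q @` (cdom Q `&` cdom P)) y.
    by apply: open_nbhs_nbhs; split => //; exists u.
  move=> /hc; rewrite near_simpl /=; apply: (@filterS _ _ (nbhs_filter _)) => h [w [Qw Pw] e].
  by rewrite /c /= -e !cmapK.
have h3 : df (cmap P u, a') = cchange P Q u a'.
  by apply: (is_ddir_unique hE (fdf _ _ Au)); exact: is_ddir_cchange.
rewrite -h3 -/(l _) -/(l a).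
exact: (@is_ddir_unique R R^o R^o _ _ _ _ _ (@norm_hausdorff _ _) h1 h2).
Qed.

Lemma gramE p u a b : cdom (chart_at M p) u ->
  gram M (G M) (chart_at M p) (cmap (chart_at M p) u)
    (cchange (chart_at M u) (chart_at M p) u a)
    (cchange (chart_at M u) (chart_at M p) u b) = G M u a b.
Proof. by move=> pu; rewrite /gram cmapK // !cchangeK. Qed.

Lemma gram_sym p x a b : gram M (G M) p x a b = gram M (G M) p x b a.
Proof. exact: G_sym. Qed.

(** Smoothness is expressed in charts, whereas a velocity also requires [c] to be continuous into
    [U]; this is recovered by composing with the inverse chart. *)
Lemma smooth_into_velocity (O : set R^o) (c : R -> U) t :
  smooth_into M O c -> O t -> is_velocity M c t (velocity M c t).
Proof.
move=> sc Ot; have [B [oB Bt dB sB]] := sc _ Ot.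
have [df [fdf _]] := smooth_differential sB.
have /= d := fdf t 1 Bt.
split; last by rewrite /velocity (ddirE hE d).
have cc : {for t, continuous (cmap (chart_at M (c t)) \o c : R^o -> E)}.
  exact: (smooth_continuous sB).
have : (cinv (chart_at M (c t)) \o (cmap (chart_at M (c t)) \o c : R^o -> E)) @ t
    --> cinv (chart_at M (c t)) (cmap (chart_at M (c t)) (c t)).
  apply: (@cvg_comp _ _ _ (cmap (chart_at M (c t)) \o c) _ _
    (nbhs (cmap (chart_at M (c t)) (c t)))); first exact: cc.
  exact/cinv_cont/chart_atP.
rewrite cmapK; last exact: chart_atP.
apply: cvg_trans; apply: near_eq_cvg.
have : \forall y \near t, B y by exact: open_nbhs_nbhs.
by apply: filterS => s Bs /=; rewrite cmapK //; exact: dB.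
Qed.

(** In the fixed chart at [c t] the derivative splits into that of the metric coefficients and those
    of the two fields. Parallelism turns the latter into minus two Christoffel terms, whose sum is
    exactly the derivative of the coefficients along [c]: the other terms of the first-kind formula
    occur with opposite signs. *)
Lemma covderiv_metric (c : R -> U) (V W : R -> E) t :
  is_velocity M c t (velocity M c t) ->
  is_covderiv M c V t 0 -> is_covderiv M c W t 0 ->
  is_derive (t : R^o) (1 : R^o) (fun s => G M (c s) (V s) (W s)) 0.
Proof.
move=> [cc dc] [V' [dV hV]] [W' [dW hW]]; apply/is_ddirP.
set p := chart_at M (c t) in dc dV dW hV hW *.
have pc := chart_atP M (c t) : cdom p (c t).
set x' := velocity M c t in dc hV hW *.
pose f : E * E * E -> R^o := fun z => gram M (G M) p z.1.1 z.1.2 z.2.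
pose A : set (E * E * E) := cmap p @` cdom p `*` setT `*` setT.
have oA : open A.
  by do 2 (apply: open_setX; last exact: openT); exact: cimg_open.
have [df [fdf dfc]] := smooth_differential (G_smooth M (c t)).
set v := V t in hV *; set w := W t in hW *.
pose z (s : R) := (cmap p (c s), cchange (chart_at M (c s)) p (c s) (V s),
  cchange (chart_at M (c s)) p (c s) (W s)).
have zt : z t = (cmap p (c t), v, w) by rewrite /z !cchange_id.
have Az : A (z t) by rewrite zt; split => //; split => //; exists (c t).
have dz : is_ddir (z : R^o -> E * E * E) t 1 (x', V', W').
  by apply: is_ddir_pair => //; exact: is_ddir_pair.
have := @differential_curve _ _ A f df fdf oA dfc z t _ Az dz.
have dfE : df (z t, (x', V', W')) = 0.
  have AD := @differentialD _ _ A f df fdf oA dfc.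
  have -> : (x', V', W') = (x', 0, 0) + ((0, V', 0) + (0, 0, W')).
    by congr (_, _, _); rewrite /= ?addr0 ?add0r.
  rewrite !AD //.
  have D1 a b e : df (cmap p (c t), a, b, (e, 0, 0)) =
      ddir (fun y => gram M (G M) p y a b : R^o) (cmap p (c t)) e.
    symmetry; apply: ddirE; first exact: norm_hausdorff.
    have Aab : A (cmap p (c t), a, b) by split => //; split => //; exists (c t).
    have := fdf _ (e, 0, 0) Aab; apply: cvg_trans; apply: near_eq_cvg; near=> h.
    by rewrite /= !scaler0 !addr0.
  have D2 : df (z t, (0, V', 0)) = G M (c t) V' w.
    apply: (@is_ddir_unique _ _ R^o f (z t) (0, V', 0)); [exact: norm_hausdorff|exact: fdf|].
    rewrite /is_ddir zt /=; apply: cvg_near_cst; near=> h.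
    rewrite /f /p /= !scaler0 !addr0 !gram_center GD GZ addrC addKr /GRing.scale /= mulKf //.
    by near: h; exact: nbhs_dnbhs_neq.
  have D3 : df (z t, (0, 0, W')) = G M (c t) W' v.
    apply: (@is_ddir_unique _ _ R^o f (z t) (0, 0, W')); [exact: norm_hausdorff|exact: fdf|].
    rewrite /is_ddir zt /=; apply: cvg_near_cst; near=> h.
    rewrite /f /p /= !scaler0 !addr0 !gram_center GDr GZr addrC addKr /GRing.scale /= mulKf.
      by rewrite G_sym.
    by near: h; exact: nbhs_dnbhs_neq.
  rewrite D2 D3 zt D1.
  have := hV w; have := hW v; rewrite !G0 /christoffel.
  (* The Christoffel terms contain the derivatives along [x'] of the coefficients at [(v, w)] and at
     [(w, v)]; symmetry identifies them. *)
  have S a b e : ddir (fun y => gram M (G M) p y a b : R^o) (cmap p (c t)) e =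
    ddir (fun y => gram M (G M) p y b a : R^o) (cmap p (c t)) e.
    have -> : (fun y : E => gram M (G M) p y a b : R^o) = (fun y => gram M (G M) p y b a).
      by apply/funext => y; exact: gram_sym.
    by [].
  rewrite (S w v x').
  set d1 := ddir _ _ _; set d2 := ddir _ _ _; set d3 := ddir _ _ _.
  by move: d1 d2 d3 (G _ _ _ _) (G _ _ _ _) => d1 d2 d3 g1 g2 e1 e2; lra.
(* The derivative was computed in the single chart at [c t]; near [t], [gramE] translates it back to
   [G] on the moving tangent spaces. *)
rewrite dfE; apply: is_ddir_near.
have : \forall s \near t, cdom p (c s).
  by apply: cc; apply: open_nbhs_nbhs; split => //; exact: cdom_open.
by apply: filterS => s ps; rewrite /f /= gramE.
Unshelve. all: end_near. Qed.

End manifolds.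

(** * Geodesics and descent *)

Section geodesics.
Context {R : realType} {E : tvsType R} {U : topologicalType}.
Variable M : riemannian E U.

Let hE : hausdorff_space E := model_hausdorff M.

Lemma tnorm_ge0 u v : 0 <= tnorm M u v.
Proof. exact: sqrtr_ge0. Qed.

Lemma tnorm_sqr u v : tnorm M u v ^+ 2 = G M u v v.
Proof. by rewrite sqr_sqrtr // G_ge0. Qed.

Lemma tnormZ u a v : tnorm M u (a *: v) = `|a| * tnorm M u v.
Proof.
by rewrite /tnorm GZ GZr mulrA -expr2 sqrtrM ?sqr_ge0 // sqrtr_sqr.
Qed.

Lemma tnormN u v : tnorm M u (- v) = tnorm M u v.
Proof. by rewrite -scaleN1r tnormZ normrN1 mul1r. Qed.

Lemma tnorm_eq0 u v : tnorm M u v = 0 -> v = 0.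
Proof. by move=> h; apply: (@G_eq0 _ _ _ M u); rewrite -tnorm_sqr h expr0n. Qed.

Lemma tnorm_cauchy u v w : `|G M u v w| <= tnorm M u v * tnorm M u w.
Proof.
rewrite -(ler_pXn2r (ltn0Sn 1)) ?nnegrE ?mulr_ge0 ?tnorm_ge0 //.
rewrite exprMn !tnorm_sqr real_normK ?num_real //.
have [->|v0] := eqVneq v 0; first by rewrite !G0 expr0n mul0r.
have vv := G_pos M u v0.
have := G_ge0 M u (w - (G M u v w / G M u v v) *: v).
rewrite GB !GBr GZ !GZr !GZ (G_sym M u w v).
set a := G M u v w; set b := G M u v v in vv *; set c := G M u w w => h.
have : 0 <= b * (c - a / b * a - (a / b * a - a / b * (a / b * b))).
  by rewrite mulr_ge0 // ltW.
by rewrite (_ : b * _ = b * c - a ^+ 2) ?subr_ge0 //; field; exact: lt0r_neq0.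
Qed.

Lemma tnormD u v w : tnorm M u (v + w) <= tnorm M u v + tnorm M u w.
Proof.
rewrite -(ler_pXn2r (ltn0Sn 1)) ?nnegrE ?addr_ge0 ?tnorm_ge0 //.
rewrite sqrrD !tnorm_sqr GD !GDr (G_sym M u w v).
have := le_trans (ler_norm _) (tnorm_cauchy u v w).
rewrite -mulr_natl; lra.
Qed.

Lemma tnorm_dist u v w : `|tnorm M u v - tnorm M u w| <= tnorm M u (v - w).
Proof.
have := tnormD u (v - w) w; rewrite subrK => h1.
have := tnormD u (w - v) v; rewrite subrK -(opprB v w) tnormN => h2.
by rewrite ler_norml; apply/andP; split; lra.
Qed.

Lemma parallel_G (c : R -> U) (V W : R -> E) :
  (forall t, 0 <= t <= 1 -> is_velocity M c t (velocity M c t)) ->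
  (forall t, 0 <= t <= 1 -> is_covderiv M c V t 0) ->
  (forall t, 0 <= t <= 1 -> is_covderiv M c W t 0) ->
  forall s, 0 <= s <= 1 -> G M (c s) (V s) (W s) = G M (c 0) (V 0) (W 0).
Proof.
move=> vc cV cW s /andP[s0 s1].
have d t : 0 <= t <= s ->
    is_derive (t : R^o) (1 : R^o) (fun s => G M (c s) (V s) (W s)) 0.
  move=> /andP[t0 ts]; have t01 : 0 <= t <= 1 by rewrite t0 (le_trans ts).
  by apply: covderiv_metric; [exact: vc | exact: cV | exact: cW].
have [||x _] := @MVT_segment R (fun s => G M (c s) (V s) (W s)) (fun=> 0) 0 s s0.
- by move=> x; rewrite in_itv /= => /andP[x0 xs]; apply: d; rewrite !ltW.
- apply: derivable_within_continuous => k; rewrite in_itv /= => k01.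
  by have [] := d k k01.
by rewrite mul0r => /eqP; rewrite subr_eq0 => /eqP.
Qed.

Lemma is_ddir_scalel (X : tvsType R) (f : X -> E) (s : R) x v y :
  is_ddir f x v y -> is_ddir (fun z => s *: f z) x v (s *: y).
Proof.
move=> h; have := @tvs_cvgZ _ _ _ (dnbhs_filter _) _ _ _ _ _
  (@cvg_cst _ s _ _ (dnbhs_filter _)) h.
apply: cvg_trans; apply: near_eq_cvg; near=> k.
by rewrite -scalerBr !scalerA mulrC.
Unshelve. all: end_near. Qed.

Lemma is_ddir_comp_scale (f : R^o -> E) (s t : R) y :
  is_ddir f (s * t) 1 y -> is_ddir (fun r : R^o => f (s * r)) t 1 (s *: y).
Proof.
move=> h; have {h} := @is_ddirZ _ _ _ f (s * t) 1 y s h.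
apply: cvg_trans; apply: near_eq_cvg; near=> h.
by congr (_ *: (f _ - _)); rewrite mulrDr /GRing.scale /= !mulr1 (mulrC s h).
Unshelve. all: end_near. Qed.

Lemma smooth_into_scale (O : set R^o) (c : R -> U) (s : R) :
  smooth_into M O c ->
  smooth_into M [set r : R^o | O (s * r)] (fun r => c (s * r)).
Proof.
move=> sc x Ox; have [B [oB Bx dB sB]] := sc _ Ox.
have cs : continuous (fun r : R^o => s * r : R^o) by exact: mulrl_continuous.
exists ((fun r : R^o => s * r : R^o) @^-1` B); split.
- by apply: open_comp => // r _; exact: cs.
- by [].
- by move=> y; exact: dB.
apply: (@smooth_affine R R^o R^o E B _ (fun r => s * r) (fun r => s * r)) sB => //.
by move=> r v h; rewrite mulrDr /GRing.scale /= mulrCA.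
Qed.

Lemma velocity_scale (O : set R^o) (c : R -> U) (s t : R) :
  smooth_into M O c -> O (s * t) ->
  velocity M (fun r => c (s * r)) t = s *: velocity M c (s * t).
Proof.
move=> sc Ost; apply: ddirE => //.
have [_ h] := smooth_into_velocity sc Ost.
exact: (is_ddir_comp_scale h).
Qed.

Lemma cchangeZ p q u (a : R) v : cdom (chart_at M p) u -> cdom (chart_at M q) u ->
  cchange (chart_at M p) (chart_at M q) u (a *: v) =
  a *: cchange (chart_at M p) (chart_at M q) u v.
Proof.
by move=> pu qu; apply: ddirE => //; apply/is_ddirZ/is_ddir_cchange.
Qed.

Lemma is_ddir_gram p u a b e : cdom (chart_at M p) u ->
  is_ddir (fun y => gram M (G M) (chart_at M p) y a b : R^o)
    (cmap (chart_at M p) u) e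
    (ddir (fun y => gram M (G M) (chart_at M p) y a b : R^o)
      (cmap (chart_at M p) u) e).
Proof.
move=> pu; have [df [fdf _]] := smooth_differential (G_smooth M p).
suff h : is_ddir (fun y => gram M (G M) (chart_at M p) y a b : R^o)
    (cmap (chart_at M p) u) e (df (cmap (chart_at M p) u, a, b, (e, 0, 0))).
  by rewrite (ddirE (@norm_hausdorff _ _) h).
have H := fdf (cmap (chart_at M p) u, a, b) (e, 0, 0).
have {}H : is_ddir _ _ _ _ := H (conj (conj (ex_intro2 _ _ u pu erefl) I) I).
move: H; apply: cvg_trans; apply: near_eq_cvg; near=> h.
by rewrite /= !scaler0 !addr0.
Unshelve. all: end_near. Qed.

Lemma ddir_gramZ p u k l a b e : cdom (chart_at M p) u ->
  ddir (fun y => gram M (G M) (chart_at M p) y (k *: a) (l *: b) : R^o)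
    (cmap (chart_at M p) u) e =
  k * l * ddir (fun y => gram M (G M) (chart_at M p) y a b : R^o)
    (cmap (chart_at M p) u) e.
Proof.
move=> pu; apply: ddirE; first exact: norm_hausdorff.
have := @is_ddir_linear _ _ _ _ (fun y : R^o => k * l * y : R^o) _ _ _ _ _
  (@is_ddir_gram p u a b e pu).
move=> h; apply: is_ddir_near (h _ _).
- have : \forall y \near cmap (chart_at M p) u,
      (cmap (chart_at M p) @` cdom (chart_at M p)) y.
    by apply: open_nbhs_nbhs; split; [exact: cimg_open | exists u].
  apply: filterS => _ [w pw <-]; rewrite /= /gram cmapK //.
  have ww := chart_atP M w.
  by rewrite !cchangeZ // GZ GZr mulrA.
- by move=> r y z; rewrite /GRing.scale /=; ring.
- exact: mulrl_continuous.
Qed.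

Lemma christoffelZ p u (s : R) a b z : cdom (chart_at M p) u ->
  christoffel M (chart_at M p) (cmap (chart_at M p) u) (s *: a) (s *: b) z =
  s ^+ 2 * christoffel M (chart_at M p) (cmap (chart_at M p) u) a b z.
Proof.
move=> pu.
pose D v w e : R := ddir (fun y => gram M (G M) (chart_at M p) y v w : R^o)
    (cmap (chart_at M p) u) e.
have De v w e : D v w (s *: e) = s * D v w e.
  by apply: ddirE; [exact: norm_hausdorff | apply/is_ddirZ/is_ddir_gram].
have Dll v w e : D (s *: v) (s *: w) e = s * s * D v w e by exact: ddir_gramZ.
have Dl v w e : D (s *: v) w e = s * D v w e.
  by have := ddir_gramZ s 1 v w e pu; rewrite scale1r mulr1.
change (2^-1 * (D (s *: b) z (s *: a) + D (s *: a) z (s *: b)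
  - D (s *: a) (s *: b) z) = s ^+ 2 * (2^-1 * (D b z a + D a z b - D a b z))).
rewrite Dll !De !Dl; move: (D _ _ _) (D _ _ _) (D _ _ _) => d1 d2 d3; ring.
Qed.

(** The velocity is multiplied by [s], its derivative and the Christoffel term both by [s ^+ 2], so
    the geodesic equation persists, even for [s = 0]. Initial segments thus become geodesics on
    [0, 1], to which the Lipschitz condition applies. *)
Lemma geodesic_scale (c : R -> U) (s : R) : 0 <= s <= 1 ->
  geodesic M c -> geodesic M (fun r => c (s * r)).
Proof.
move=> /andP[s0 s1] [B [oB B01 sc gc]].
have cs : continuous (fun r : R^o => s * r : R^o) by exact: mulrl_continuous.
have oB' : open [set r : R^o | B (s * r)].
  by apply: (@open_comp _ _ (fun r : R^o => s * r : R^o)) => // r _; exact: cs.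
exists [set r : R^o | B (s * r)]; split => //.
- move=> r /=; rewrite in_itv /= => /andP[r0 r1]; apply: B01.
  by rewrite /= in_itv /= mulr_ge0 // mulr_ile1.
- exact: smooth_into_scale.
move=> t Bt; have [V' [dV hV]] := gc _ Bt.
exists (s *: (s *: V')); split; last first.
  move=> z; rewrite (velocity_scale sc Bt) christoffelZ; last exact: chart_atP.
  have := hV z; rewrite !G0 => h.
  by rewrite !GZ mulrA -expr2 -mulrDr -h mulr0.
set p := chart_at M (c (s * t)) in dV *.
have := is_ddir_scalel (s := s) (is_ddir_comp_scale dV).
apply: is_ddir_near.
have [cc _] := smooth_into_velocity (smooth_into_scale sc) Bt.
have h2 : \forall r \near t, cdom p (c (s * r)).
  apply: cc; apply: open_nbhs_nbhs; split; first exact: cdom_open.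
  exact: chart_atP.
have h3 : \forall r \near (t : R^o), B (s * r) by exact: open_nbhs_nbhs.
apply: filterS2 h2 h3 => r pr Br.
by rewrite (velocity_scale sc Br) cchangeZ //; exact: chart_atP.
Qed.


Lemma velocity_scale01 (c : R -> U) (s t : R) : geodesic M c ->
  0 <= s <= 1 -> 0 <= t <= 1 ->
  velocity M (fun r => c (s * r)) t = s *: velocity M c (s * t).
Proof.
move=> [B [oB B01 sc gc]] /andP[s0 s1] /andP[t0 t1].
apply: (velocity_scale sc); apply: B01.
by rewrite /= in_itv /= mulr_ge0 // mulr_ile1.
Qed.

(** The velocity field of a geodesic is parallel along it. *)
Lemma geodesic_speed (c : R -> U) t : geodesic M c -> 0 <= t <= 1 ->
  tnorm M (c t) (velocity M c t) = tnorm M (c 0) (velocity M c 0).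
Proof.
move=> [B [oB B01 sc gc]] t01; rewrite /tnorm; congr Num.sqrt.
apply: parallel_G => // r r01.
- by apply: (smooth_into_velocity sc); apply: B01; rewrite /= in_itv.
- by apply: gc; apply: B01; rewrite /= in_itv.
- by apply: gc; apply: B01; rewrite /= in_itv.
Qed.

Lemma geodesic_length (c : R -> U) : geodesic M c ->
  clength M c = (tnorm M (c 0) (velocity M c 0))%:E.
Proof.
move=> gc; rewrite /clength.
under eq_integral.
  move=> t; rewrite inE /= in_itv /= => t01; rewrite geodesic_speed //; over.
rewrite integral_cst //= lebesgue_measure_itv /= lte_fin ltr01.
by rewrite sube0 mule1.
Qed.

Lemma geodesic_dist (c : R -> U) : geodesic M c ->
  (dist M (c 0%R) (c 1%R) <=
    (tnorm M (c 0%R) (velocity M c 0%R))%:E)%E.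
Proof.
move=> gc; rewrite -geodesic_length //.
apply: ereal_inf_lbound => /=; rewrite -[X in pw_curve _ _ _ X]adde0.
apply: pw_cons; last exact: pw_nil.
by case: gc => [B [oB B01 sc _]]; exists B.
Qed.

Lemma exp_geodesic_scale (c : R -> U) s : geodesic M c -> 0 <= s <= 1 ->
  is_exp M (c 0) (s *: velocity M c 0) (c s).
Proof.
move=> gc s01; exists (fun r => c (s * r)); split => [||||r _].
- exact: geodesic_scale.
- by rewrite mulr0.
- by rewrite velocity_scale01 ?lexx ?ler01 ?mulr0.
- by rewrite mulr1.
- exact: I.
Qed.

(* log_exists provides a preimage of y under exp_u of length d(u, y) <= |v|,
   which is v because exp_u is injective below the injectivity radius; this
   replaces the Gauss lemma. *)
Lemma short_geodesic_dist u v y : log_exists M ->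
  ((tnorm M u v)%:E < inj_radius M)%E -> is_exp M u v y ->
  dist M u y = (tnorm M u v)%:E.
Proof.
move=> Hlog vi ey; have [c [gc c0 cv c1 _]] := ey.
have dv : (dist M u y <= (tnorm M u v)%:E)%E.
  by have := geodesic_dist gc; rewrite c0 c1 cv.
have [w ew wd] := Hlog u y (le_trans dv (ltW vi)).
have : ((tnorm M u v)%:E < inj_radius_at M u)%E.
  by apply: (lt_le_trans vi); apply: ereal_inf_lbound; exists u.
move=> /ereal_sup_gt[_ [r [r0 [e [l [eE _ _ le _]]]] <-]] vr.
have wr : tball M u r%:E w by rewrite /tball /= wd (le_lt_trans dv).
have ye := (eE v vr y).1 ey; have ye' := (eE w wr y).1 ew.
by rewrite -wd -(le w wr) -(le v vr) -ye -ye'.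
Qed.

Lemma short_min_geodesic (c : R -> U) : log_exists M ->
  geodesic M c -> ((tnorm M (c 0) (velocity M c 0))%:E < inj_radius M)%E ->
  min_geodesic M c (c 0) (c 1).
Proof.
move=> Hlog gc vi; split => //; rewrite geodesic_length //.
rewrite (short_geodesic_dist Hlog vi) //.
by have := @exp_geodesic_scale c 1 gc; rewrite scale1r; apply; rewrite lexx ler01.
Qed.

(** Gradients at the two ends live in different tangent spaces. Here [X] is the end gradient
    transported to [c 0]; parallel transport preserves its norm and its pairing with the velocity,
    so every comparison can be made at [c 0]. *)
Lemma grad_transport (A : set U) (h : U -> R) L (c : R -> U) : log_exists M ->
  lipschitz_diff M A h L -> geodesic M c -> A (c 0) -> A (c 1) ->
  ((tnorm M (c 0) (velocity M c 0))%:E < inj_radius M)%E ->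
  exists X, [/\ tnorm M (c 0) (X - grad M h (c 0)) <=
                  L * tnorm M (c 0) (velocity M c 0),
    G M (c 1) (grad M h (c 1)) (velocity M c 1) = G M (c 0) X (velocity M c 0) &
    tnorm M (c 1) (grad M h (c 1)) = tnorm M (c 0) X].
Proof.
move=> Hlog [L0 _ hL] gc A0 A1 vi.
have e1 : is_exp M (c 0) (velocity M c 0) (c 1).
  by have := @exp_geodesic_scale c 1 gc; rewrite scale1r; apply; rewrite lexx ler01.
have dE := short_geodesic_dist Hlog vi e1.
have mg := short_min_geodesic Hlog gc vi.
have [|X tX hX] := hL _ _ A0 A1 _ _ mg; first by rewrite dE ltW.
rewrite dE -EFinM lee_fin in hX.
exists X; move: tX => [V [B' [oB' B'01 cV V1 V0]]].
have [B [oB B01 sc gcv]] := gc.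
have vel r : 0 <= r <= 1 -> is_velocity M c r (velocity M c r).
  by move=> r01; apply: (smooth_into_velocity sc); apply: B01; rewrite /= in_itv.
have cov r : 0 <= r <= 1 -> is_covderiv M c V r 0.
  by move=> r01; apply: cV; apply: B'01; rewrite /= in_itv.
have one : 0 <= (1 : R) <= 1 by apply/andP; split; [exact: ler01 | exact: lexx].
split => //.
- have vcov r : 0 <= r <= 1 -> is_covderiv M c (velocity M c) r 0.
    by move=> r01; apply: gcv; apply: B01; rewrite /= in_itv.
  by have := parallel_G vel cov vcov one; rewrite V1 V0.
- by rewrite /tnorm -V1 -V0; congr Num.sqrt; apply: parallel_G.
Qed.

Lemma grad_norm_lipschitz (A : set U) (h : U -> R) L u v y : log_exists M ->
  lipschitz_diff M A h L -> is_exp M u v y -> A u -> A y ->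
  ((tnorm M u v)%:E < inj_radius M)%E ->
  `|tnorm M y (grad M h y) - tnorm M u (grad M h u)| <= L * tnorm M u v.
Proof.
move=> Hlog hL [c [gc <- <- <- _]] A0 A1 vi.
have [X [hX _ ->]] := grad_transport Hlog hL gc A0 A1 vi.
exact: le_trans (tnorm_dist _ _ _) hX.
Qed.

Lemma gradP (h : U -> R) u : has_gradient M h u -> is_gradient M h u (grad M h u).
Proof. by move=> [g hg]; rewrite /grad; case: xgetP => // /(_ g). Qed.

(** [is_gradient] only speaks of curves at time 0, so the curve is translated by [t]. *)
Lemma grad_along (O : set R^o) (c : R -> U) (h : U -> R) (t : R) :
  open O -> smooth_into M O c -> O t -> has_gradient M h (c t) ->
  is_derive (t : R^o) (1 : R^o) (h \o c : R^o -> R^o)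
    (G M (c t) (grad M h (c t)) (velocity M c t)).
Proof.
move=> oO sc Ot hg.
have shift (s : R) : O (s + t) ->
    is_velocity M (fun r => c (r + t)) s (velocity M c (s + t)).
  move=> Os; have [cc dc] := smooth_into_velocity sc Os; split.
    apply: (@continuous_comp R R U (fun r => r + t) c) => //.
    by apply: cvgD; [exact: cvg_id | exact: cvg_cst].
  move: dc; apply: cvg_trans; apply: near_eq_cvg; near=> k.
  by rewrite /= addrAC.
have [e /= e0 eO] : nbhs (t : R^o) O by exact: open_nbhs_nbhs.
have := gradP hg; move=> /(_ (fun r => c (r + t)) (velocity M c t)).
rewrite add0r => H.
have H1 : exists2 e : R, 0 < e &
    forall s, `|s| < e -> exists w, is_velocity M (fun r => c (r + t)) s w.
  exists e => // s se; exists (velocity M c (s + t)); apply: shift.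
  by apply: eO; rewrite /= opprD addrCA subrr addr0 normrN.
have H2 : is_velocity M (fun r => c (r + t)) 0 (velocity M c t).
  by have := shift 0; rewrite add0r; apply.
have {}H := (is_ddirP _ _ _).2 (H H1 erefl H2).
apply/is_ddirP; move: H; apply: cvg_trans; apply: near_eq_cvg; near=> k.
by rewrite /= !add0r (addrC t).
Unshelve. all: end_near. Qed.

(** The derivative of [h] along the geodesic at time [s] exceeds its value [a] at time 0 by at most
    [L * (s * b) * b]: transport along the initial segment of length [s * b], then Cauchy-Schwarz.
    Integrated over [0, 1], this produces the factor [L / 2]. The geodesic has to stay in [A], where
    the gradient is controlled. *)
Lemma descent (A : set U) (h : U -> R) L u v y : log_exists M ->
  lipschitz_diff M A h L -> exp_in M A u v y ->
  ((tnorm M u v)%:E < inj_radius M)%E ->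
  h y <= h u + G M u (grad M h u) v + L / 2 * tnorm M u v ^+ 2.
Proof.
move=> Hlog hL [c [gc c0 cv c1 cA]] vi; have [L0 hg _] := hL.
have [B [oB B01 sc _]] := gc.
set a := G M u (grad M h u) v; set b := tnorm M u v in vi *.
have b0 : 0 <= b by exact: tnorm_ge0.
pose D s := G M (c s) (grad M h (c s)) (velocity M c s).
have Dle s : 0 <= s <= 1 -> D s <= a + L * b ^+ 2 * s.
  (* The identity obtained from transport carries a factor [s], to be cancelled below; [s = 0] is
     treated apart. *)
  move=> /andP[s0 s1]; have [->|sn0] := eqVneq s 0.
    by rewrite /D c0 cv -/a mulr0 addr0.
  have s01 : 0 <= s <= 1 by rewrite s0.
  have gs := geodesic_scale s01 gc.
  have v0 : velocity M (fun r => c (s * r)) 0 = s *: v.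
    by rewrite velocity_scale01 ?lexx ?ler01 ?mulr0 ?cv.
  have v1 : velocity M (fun r => c (s * r)) 1 = s *: velocity M c s.
    by rewrite velocity_scale01 ?lexx ?ler01 ?mulr1.
  have /= := @grad_transport A h L _ Hlog hL gs.
  rewrite v0 v1 mulr0 mulr1 c0 tnormZ ger0_norm // => H.
  have [||| X [hX eX _]] := H.
  - by rewrite -c0; apply: cA; rewrite lexx ler01.
  - exact: cA.
  - by apply: le_lt_trans vi; rewrite lee_fin ler_piMl.
  move: eX; rewrite !GZr => /(mulfI sn0); rewrite -/(D s) => ->.
  rewrite -(subrK (grad M h u) X) GD addrC lerD2l.
  apply: (le_trans (ler_norm _)); apply: (le_trans (tnorm_cauchy _ _ _)).
  rewrite -/b (_ : _ * s = L * (s * b) * b); last by ring.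
  exact: ler_wpM2r.
(* [q] is the primitive, zero at 0, of the bound in [Dle]. The mean value theorem for [h \o c] minus
   [q] takes the place of integrating [D]. *)
pose q (s : R^o) : R^o := a * s + (L * b ^+ 2 / 2) * s ^+ 2.
pose f (s : R^o) : R^o := h (c s) - q s.
have df s : 0 <= s <= 1 -> is_derive (s : R^o) (1 : R^o) f (D s - (a + L * b ^+ 2 * s)).
  move=> s01; apply: is_deriveB.
    apply: (grad_along oB sc); first by apply: B01; rewrite /= in_itv.
    by apply: hg; exact: cA.
  rewrite /q; apply: is_derive_eq.
  by rewrite /GRing.scale /=; field.
have [||s] := @MVT_segment R f (fun s => D s - (a + L * b ^+ 2 * s)) 0 1 ler01.
- by move=> x; rewrite in_itv /= => /andP[x0 x1]; apply: df; rewrite !ltW.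
- apply: derivable_within_continuous => k; rewrite in_itv /= => k01.
  by have [] := df k k01.
rewrite in_itv /= subr0 mulr1 => s01 fE.
have := Dle s s01; rewrite -subr_le0 -fE /f /q c0 c1 expr1n expr0n /= !mulr1 !mulr0.
lra.
Qed.

End geodesics.

(** * Stationarity of limit points in the topology of the manifold *)

Section limit_points.
Context {R : realType} {E : tvsType R} {U : topologicalType}.
Variable M : riemannian E U.

Lemma tnorm_continuous u : continuous (fun v : E => tnorm M u v : R^o).
Proof.
move=> v; apply: (@continuous_comp _ _ _ (fun v : E => G M u v v : R^o) Num.sqrt).
  apply: (@continuous_comp _ _ _ (fun v : E => (v, v))
    (fun z : E * E => G M u z.1 z.2 : R^o)).
    by apply: (@cvg_pair _ _ _ _ (nbhs v) (nbhs v)); exact: cvg_id.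
  exact: G_continuous.
exact: sqrt_continuous.
Qed.

(** The topology of [U] is tied to the metric here: the local inverse [l] of the exponential map is
    continuous at [v] with value 0, so its norm is small near [v]. *)
Lemma exp_near v (eps : R) : (0 < inj_radius M)%E -> 0 < eps ->
  \forall y \near v, exists2 w, is_exp M v w y & tnorm M v w < eps.
Proof.
move=> i0 eps0.
have : (0 < inj_radius_at M v)%E.
  by apply: (lt_le_trans i0); apply: ereal_inf_lbound; exists v.
move=> /ereal_sup_gt[_ [r [r0 [e [l [eE _ oW le sl]]]] <-]] _.
set W := e @` _ in oW sl.
have B0 : tball M v r%:E 0 by rewrite /tball /= /tnorm G0 sqrtr0 lte_fin.
(* A geodesic from [v] rescaled by 0 is constant, so the zero vector is mapped to [v]. *)
have ev : e 0 = v.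
  have [c [gc c0 cv _ _]] := (eE 0 B0 (e 0)).2 erefl.
  have := exp_geodesic_scale (s := 0) gc.
  rewrite lexx ler01 scale0r c0 => /(_ isT) h.
  by rewrite ((eE 0 B0 v).1 h).
have Wv : W v by exists 0.
have lv : l v = 0 by rewrite -ev le.
have pv := chart_atP M v.
have cl : {for v, continuous l}.
  have h : {for cmap (chart_at M v) v, continuous (l \o cinv (chart_at M v))}.
    by apply: (smooth_continuous (sl v)); exists v.
  have : (l \o cinv (chart_at M v)) \o cmap (chart_at M v) @ v --> l v.
    have <- : (l \o cinv (chart_at M v)) (cmap (chart_at M v) v) = l v.
      by rewrite /= cmapK.
    exact: (@continuous_comp _ _ _ (cmap (chart_at M v))
      (l \o cinv (chart_at M v)) v (cmap_cont pv) h).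
  apply: cvg_trans; apply: near_eq_cvg.
  have : \forall y \near v, cdom (chart_at M v) y.
    by apply: open_nbhs_nbhs; split => //; exact: cdom_open.
  by apply: filterS => y py /=; rewrite cmapK.
have ct : (fun y => tnorm M v (l y)) @ v --> (0 : R).
  have <- : tnorm M v (l v) = 0 by rewrite lv /tnorm G0 sqrtr0.
  exact: (@continuous_comp _ _ _ l (fun w : E => tnorm M v w : R^o) v cl
    (@tnorm_continuous _ _)).
have h1 : \forall y \near v, W y by exact: open_nbhs_nbhs.
have h2 : \forall y \near v, tnorm M v (l y) < eps.
  have : \forall z \near (0 : R), z < eps by exact: lt_nbhsl.
  exact: ct.
apply: filterS2 h1 h2 => _ [w Bw <-]; rewrite le // => ?; exists w => //.
exact/(eE w Bw).
Qed.

Lemma radius_below_inj : (0 < inj_radius M)%E ->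
  exists2 r : R, 0 < r & (r%:E <= inj_radius M)%E.
Proof.
case: (inj_radius M) => [r r0|_|//]; first by exists r.
by exists 1 => //; rewrite leey.
Qed.

(** A point topologically close to [v] is reached by a short geodesic, along which the norm of the
    gradient changes by at most [L] times the length. Only this lower semicontinuity matters for
    limit points. *)
Lemma grad_near (A : set U) (h : U -> R) L v (eps : R) : log_exists M ->
  (0 < inj_radius M)%E -> lipschitz_diff M A h L -> A v -> 0 < eps ->
  \forall y \near v, A y ->
    tnorm M v (grad M h v) <= tnorm M y (grad M h y) + eps.
Proof.
move=> Hlog i0 hL Av e0; have [L0 _ _] := hL.
have [r r0 ri] := radius_below_inj i0.
(* The bound [r] keeps the geodesic below the injectivity radius; [eps / L] keeps the change of the
   norm within [eps]. *)
have m0 : 0 < Num.min r (eps / L) by rewrite lt_min r0 divr_gt0.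
have := @exp_near v _ i0 m0; apply: filterS => y [w ew].
rewrite lt_min => /andP[wr we] Ay.
have wi : ((tnorm M v w)%:E < inj_radius M)%E.
  by apply: lt_le_trans ri; rewrite lte_fin.
have := grad_norm_lipschitz Hlog hL ew Av Ay wi.
rewrite ler_norml => /andP[h1 _].
have : L * tnorm M v w <= eps by rewrite mulrC -ler_pdivlMr // ltW.
lra.
Qed.

Lemma cluster_stationary (A : set U) (h : U -> R) L (u : nat -> U) v :
  log_exists M -> (0 < inj_radius M)%E -> lipschitz_diff M A h L ->
  (forall n, A (u n)) -> A v ->
  tnorm M (u n) (grad M h (u n)) @[n --> \oo] --> (0 : R) ->
  cluster (u n @[n --> \oo]) v -> grad M h v = 0.
Proof.
move=> Hlog i0 hL Au Av u0 cv; apply: (@tnorm_eq0 _ _ _ M v).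
apply/eqP; rewrite eq_le tnorm_ge0 andbT; apply/ler_addgt0Pl => e e0.
have e2 : 0 < e / 2 by rewrite divr_gt0.
have near_v := grad_near Hlog i0 hL Av e2.
have near_n : \forall n \near \oo, tnorm M (u n) (grad M h (u n)) < e / 2.
  have : \forall z \near (0 : R), z < e / 2 by exact: lt_nbhsl.
  exact: u0.
have FA : (u n @[n --> \oo]) [set y | A y /\ tnorm M y (grad M h y) < e / 2].
  by move: near_n; apply: filterS.
have [y [[Ay yl] yv]] := cv _ _ FA near_v.
have := yv Ay; rewrite addr0; lra.
Qed.

End limit_points.

(** * Real sequences *)

Section series_lemmas.
Context {R : realType}.
Implicit Types (a t g x : nat -> R).

Lemma seriesS a n : series a n.+1 = series a n + a n.
Proof. by rewrite /series /= big_nat_recr. Qed.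

Lemma series_mono a : (forall n, 0 <= a n) ->
  {homo series a : m n / (m <= n)%N >-> m <= n}.
Proof. by move=> a0; apply/nondecreasing_seqP => n; rewrite seriesS lerDl. Qed.

Lemma cvgn_near_cauchy (f : nat -> R) (e : R) : cvgn f -> 0 < e ->
  exists N, forall m n, (N <= m)%N -> (N <= n)%N -> `|f m - f n| < e.
Proof.
move=> /cvg_cauchy /cauchy_ballP /(_ e) h e0.
have [[A B] /= [[N1 _ hA] [N2 _ hB]] AB] := h e0.
exists (maxn N1 N2) => m n; rewrite !geq_max => /andP[m1 m2] /andP[n1 n2].
by apply: (AB (f m, f n)); split; [exact: hA | exact: hB].
Qed.

Lemma inv_nat_lt (e : R) : 0 < e -> exists n : nat, n.+1%:R^-1 < e.
Proof.
move=> e0; exists (Num.bound e^-1); rewrite invf_plt ?posrE //.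
apply: lt_trans (archi_boundP _) _; last by rewrite ltr_nat.
by rewrite invr_ge0 ltW.
Qed.

Lemma limn_einf_eq0 g : (forall n, 0 <= g n) ->
  (forall e N, 0 < e -> exists2 n, (N <= n)%N & g n < e) ->
  limn_einf (fun n => (g n)%:E) = 0%E.
Proof.
move=> g0 gs; rewrite limn_einf_lim.
suff -> : einfs (fun n => (g n)%:E) = fun=> 0%E by exact: lim_cst.
apply/funext => N; apply/eqP; rewrite eq_le; apply/andP; split.
  apply/lee_addgt0Pr => e e0; have [n Nn ge] := gs e N e0.
  rewrite add0e; apply: (@le_trans _ _ (g n)%:E); last by rewrite lee_fin ltW.
  by apply: ereal_inf_lbound; exists n.
by apply: le_ereal_inf_tmp => _ [n _ <-]; rewrite lee_fin.
Qed.

(** If [g] stayed above [e] from [N] on, the series of [t n * g n ^+ 2] would dominate [e ^+ 2]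
    times a divergent one. *)
Lemma frequently_small t g : (forall n, 0 <= t n) -> (forall n, 0 <= g n) ->
  ~ cvgn (series t) -> cvgn (series (fun n => t n * g n ^+ 2)) ->
  forall e N, 0 < e -> exists2 n, (N <= n)%N & g n < e.
Proof.
move=> t0 g0 tdiv tg e N e0; apply: contrapT => hno.
have ge n : (N <= n)%N -> e <= g n.
  by move=> Nn; rewrite leNgt; apply/negP => ?; apply: hno; exists n.
apply: tdiv; apply: nondecreasing_is_cvgn; first exact: series_mono.
have [B Bub] : exists B, forall n, series (fun n => t n * g n ^+ 2) n <= B.
  exists (limn (series (fun n => t n * g n ^+ 2))) => n.
  apply: nondecreasing_cvgn_le => //; apply: series_mono => k.
  by rewrite mulr_ge0 // exprn_ge0.
have key n : (N <= n)%N -> e ^+ 2 * (series t n - series t N) <=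
    series (fun n => t n * g n ^+ 2) n.
  elim: n => [|n IH].
    rewrite leqn0 => /eqP ->; rewrite subrr mulr0.
    by rewrite /series /= big_geq.
  rewrite leq_eqVlt => /predU1P[->|]; last first.
    rewrite ltnS => Nn; rewrite !seriesS.
    have h : e ^+ 2 <= g n ^+ 2 by rewrite lerXn2r // ?nnegrE ?ge // ltW.
    have := IH Nn; have := ler_wpM2l (t0 n) h; lra.
  rewrite subrr mulr0 -[X in X <= _](_ : series (fun n => t n * g n ^+ 2) 0 = 0).
    by apply: series_mono => // k; rewrite mulr_ge0 // exprn_ge0.
  by rewrite /series /= big_geq.
(* The summand [series t N] accounts for the terms before [N], where [g] may be small. *)
exists (B / e ^+ 2 + series t N) => _ [n _ <-].
have [Nn|nN] := leqP N n.
  rewrite -lerBlDr ler_pdivlMr ?exprn_gt0 // mulrC.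
  exact: le_trans (key n Nn) (Bub n).
apply: (@le_trans _ _ (series t N)); first by apply: series_mono => //; exact: ltnW.
have B0 : 0 <= B by have := Bub 0%N; rewrite /series /= big_geq.
by rewrite lerDr divr_ge0 // exprn_ge0 // ltW.
Qed.

(** Corrected by three partial sums, [jn] becomes a nonincreasing sequence bounded below, hence
    convergent. This bounds the monotone sums [B], which then converge, and [jn] is a combination of
    convergent sequences. *)
Lemma descent_cvg (b L : R) (jn t g x y : nat -> R) :
  (forall n, 0 <= t n) -> (forall n, b <= jn n) ->
  cvgn (series (fun n => t n * (y n - g n ^+ 2))) ->
  cvgn (series (fun n => (t n * x n) ^+ 2)) ->
  (\forall n \near \oo, jn n.+1 <= jn n - t n * y n + L / 2 * (t n * x n) ^+ 2) ->
  cvgn jn /\ cvgn (series (fun n => t n * g n ^+ 2)).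
Proof.
move=> t0 jb cM cQ [N _ hN].
set M := series _ in cM; set Q := series _ in cQ.
set B := series (fun n => t n * g n ^+ 2).
(* In [a n.+1 - a n] the contributions [t n * g n ^+ 2] of [B] and [M] cancel; what remains is
   nonpositive by the descent inequality. *)
pose a n := jn n + B n + M n - L / 2 * Q n.
have B_mono : {homo B : m n / (m <= n)%N >-> m <= n}.
  by apply: series_mono => n; rewrite mulr_ge0 // sqr_ge0.
have B0 n : 0 <= B n.
  by rewrite -[X in X <= _](_ : B 0%N = 0) ?B_mono // /B /series /= big_geq.
have cLQ : cvgn (fun n => L / 2 * Q n) by apply: is_cvgMr.
have cMQ : cvgn (fun n => M n - L / 2 * Q n) by apply: is_cvgB.
have [c hc] : exists c, forall n, c <= M n - L / 2 * Q n.
  have [K [_ hK]] := cvg_seq_bounded cMQ.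
  (* Boundedness is given as a bound by every real above [K], hence [K + 1]. *)
  exists (- (K + 1)) => n; have /= := hK (K + 1) ltac:(lra) n I.
  by rewrite ler_norml => /andP[].
have ca : cvgn a.
  apply: (@near_nonincreasing_is_cvgn _ _ (b + c)).
    exists N => // m Nm n mn.
    have key k : (N <= k)%N -> a k.+1 <= a k.
      move=> Nk; have := hN k Nk; rewrite /a /B /M /Q !seriesS; lra.
    elim: n mn => [|n IH]; first by rewrite leqn0 => /eqP ->.
    rewrite leq_eqVlt => /predU1P[->//|]; rewrite ltnS => mn.
    exact: le_trans (key _ (leq_trans Nm mn)) (IH mn).
  exists 0%N => // n _; rewrite /a; have := jb n; have := B0 n; have := hc n; lra.
have cB : cvgn B.
  have [K [_ hK]] := cvg_seq_bounded ca.
  apply: nondecreasing_is_cvgn => //; exists (K + 1 - b - c) => _ [n _ <-].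
  have /= := hK (K + 1) ltac:(lra) n I; rewrite ler_norml => /andP[_].
  rewrite /a; have := jb n; have := hc n; lra.
split => //.
have -> : jn = (fun n => a n - B n - (M n - L / 2 * Q n)).
  by apply/funext => n; rewrite /a; lra.
by apply: is_cvgB => //; apply: is_cvgB.
Qed.

(* If g exceeded 2e after having been below e, then along that excursion
   the travelled length sum t x is at least e / L, and up to a small error it is
   at most K sum t <= K / e^2 sum t g^2, which is arbitrarily small. *)
Lemma excursion_cvg (L K : R) (t g x a : nat -> R) :
  0 < L -> 0 <= K -> (forall n, 0 <= t n) -> (forall n, 0 <= g n) ->
  (forall n, a n <= K) ->
  (forall e N, 0 < e -> exists2 n, (N <= n)%N & g n < e) ->
  t @ \oo --> (0 : R) ->
  cvgn (series (fun n => t n * g n ^+ 2)) ->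
  cvgn (series (fun n => t n * (x n - a n))) ->
  (\forall n \near \oo, g n.+1 - g n <= L * (t n * x n)) ->
  g @ \oo --> (0 : R).
Proof.
move=> L0 K0 t0 g0 aK gs tc cB cA [N1 _ hN1].
apply/cvgrPdist_lt => e' e'0; pose e := e' / 2.
have e0 : 0 < e by rewrite divr_gt0.
(* Chosen so that [L * (r * (1 + 2 * K)) = e]. The centered sum contributes less than [r]; the first
   step [t m] and the sum of the later steps are each below [r], and both carry the weight [K]. *)
pose r := e / (L * (1 + 2 * K)).
have LK : 0 < L * (1 + 2 * K) by rewrite mulr_gt0 // ltr_pwDl // mulr_ge0.
have r0 : 0 < r by rewrite divr_gt0.
have er0 : 0 < e ^+ 2 * r by rewrite mulr_gt0 // exprn_gt0.
have [N2 hN2] := cvgn_near_cauchy cA r0.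
have [N3 hN3] := cvgn_near_cauchy cB er0.
have [N4 _ hN4] : \forall n \near \oo, t n < r.
  have : \forall z \near (0 : R), z < r by exact: lt_nbhsl.
  exact: tc.
pose N := maxn (maxn N1 N2) (maxn N3 N4).
have [m0 Nm0 gm0] := gs e N e0.
exists m0 => // n /= m0n; rewrite sub0r normrN ger0_norm // ltNge; apply/negP => gn.
set A := series _ in cA hN2; set B := series _ in cB hN3.
(* [m] is the last index up to [n] at which [g] is below [e]: the start of the excursion. *)
have [m [/andP[m0m mn] gm ge]] : exists m, [/\ (m0 <= m <= n)%N, g m < e &
    forall k, (m < k <= n)%N -> e <= g k].
  elim: n m0n {gn} => [|n IH].
    rewrite leqn0 => /eqP m00; exists 0%N; split => //; first by rewrite m00.
      by rewrite -m00.
    by move=> k; rewrite leqn0 => /andP[/[swap] /eqP ->].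
  rewrite leq_eqVlt => /predU1P[<-|].
    exists m0; split; rewrite ?leqnn // => k /andP[h1 h2].
    by have := leq_trans h1 h2; rewrite ltnn.
  rewrite ltnS => /IH[m [/andP[m0m mn] gm ge]].
  have [gl|gl] := ltP (g n.+1) e.
    exists n.+1; split; rewrite ?leqnn ?andbT //.
      by rewrite (leq_trans m0m) // ltnW.
    by move=> k /andP[h1 h2]; have := leq_trans h1 h2; rewrite ltnn.
  exists m; split => //; first by rewrite m0m ltnW.
  by move=> k /andP[mk]; rewrite leq_eqVlt ltnS => /predU1P[->//|kn]; apply: ge; rewrite mk.
have Nm : (N <= m)%N by exact: leq_trans m0m.
have [m1 m2 m3 m4] : [/\ (N1 <= m)%N, (N2 <= m)%N, (N3 <= m)%N & (N4 <= m)%N].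
  by move: Nm; rewrite !geq_max => /andP[/andP[-> ->] /andP[-> ->]].
have mn' : (m < n)%N.
  rewrite ltn_neqAle mn andbT; apply/eqP => e1; move: gm; rewrite e1 => gm.
  by move: gn; rewrite leNgt => /negP; apply; move: gm e0; rewrite /e; lra.
set T := series t.
have k1 k : (m <= k)%N -> g k - g m <= L * (A k - A m + K * (T k - T m)).
  elim: k => [|k IH]; first by rewrite leqn0 => /eqP ->; rewrite !subrr mulr0 addr0 mulr0.
  rewrite leq_eqVlt => /predU1P[->|]; first by rewrite !subrr mulr0 addr0 mulr0.
  rewrite ltnS => mk; have := IH mk; rewrite /A /T !seriesS.
  have := hN1 k (leq_trans m1 mk) => /=.
  have : L * (t k * a k) <= L * (t k * K).
    by apply: ler_wpM2l; [exact: ltW|exact: ler_wpM2l].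
  set Ak := series _ k; set Am := series _ m.
  set Tk := series t k; set Tm := series t m.
  move: Ak Am Tk Tm => Ak Am Tk Tm p1 p2 p3.
  have -> : L * (Ak + t k * (x k - a k) - Am + K * (Tk + t k - Tm)) =
    L * (Ak - Am + K * (Tk - Tm)) + L * (t k * x k) +
    (L * (t k * K) - L * (t k * a k)) by ring.
  lra.
(* The comparison starts at [m.+1] because [g m] is still below [e]; the step [t m] is small on its
   own. *)
have k2 k : (m < k)%N -> (k <= n)%N -> e ^+ 2 * (T k - T m.+1) <= B k - B m.+1.
  elim: k => [//|k IH].
  rewrite ltnS leq_eqVlt => /predU1P[<- _|mk kn]; first by rewrite !subrr mulr0.
  have := IH mk (ltnW kn); rewrite /T /B !(seriesS _ k).
  have h : e ^+ 2 <= g k ^+ 2.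
    by rewrite lerXn2r // ?nnegrE ?ge // ?mk ?(ltnW kn) // ltW.
  have := ler_wpM2l (t0 k) h; lra.
have := k1 n mn; have := k2 n mn' (leqnn n).
have hA : A n - A m < r.
  by have := hN2 n m (leq_trans m2 mn) m2; rewrite ltr_norml => /andP[].
have hB : B n - B m.+1 < e ^+ 2 * r.
  have := hN3 n m.+1 (leq_trans m3 mn) (leq_trans m3 (leqnSn m)).
  by rewrite ltr_norml => /andP[].
have ht : t m < r by exact: hN4.
move=> h2 h1.
have h3 : T n - T m.+1 < r.
  by rewrite -(ltr_pM2l (exprn_gt0 2 e0)); exact: le_lt_trans h2 hB.
have TS : T m.+1 = T m + t m by exact: seriesS.
have h4 : A n - A m + K * (T n - T m) <= r * (1 + 2 * K).
  have : K * (T n - T m) <= K * (2 * r) by apply: ler_wpM2l => //; lra.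
  lra.
have h5 : L * (A n - A m + K * (T n - T m)) <= e.
  apply: (le_trans (ler_wpM2l (ltW L0) h4)).
  by rewrite mulrC -mulrA (mulrC _ L) /r divfK // lt0r_neq0.
move: gn gm h1 h5; rewrite /e; lra.
Qed.

End series_lemmas.

(** * Martingale differences *)

Section adapted.
Context {R : realType} {d : measure_display} {T : measurableType d}.

(** [S] is only a generating family. Measurability refers to [<<s S >>], placed on a copy of [T], so
    that the closure properties of measurable functions apply unchanged. *)
Definition adapted (S : set (set T)) (Z : T -> R) : Prop :=
  measurable_fun [set: g_sigma_algebraType S] (Z : g_sigma_algebraType S -> R).

Lemma adapted_sub (S S' : set (set T)) (Z : T -> R) :
  <<s S >> `<=` <<s S' >> -> adapted S Z -> adapted S' Z.
Proof. by move=> SS' mZ mD Y mY; apply: SS'; exact: mZ. Qed.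

Lemma adapted_measurable (S : set (set T)) (Z : T -> R) :
  <<s S >> `<=` measurable -> adapted S Z -> measurable_fun [set: T] Z.
Proof. by move=> SS' mZ mD Y mY; apply: SS'; exact: mZ. Qed.

End adapted.

Section second_moment.
Context {R : realType} {d : measure_display} {T : measurableType d}.
Variable P : probability T R.

Lemma integrable_sqr (X : T -> R) (c : R) : measurable_fun [set: T] X ->
  (\int[P]_w (X w ^+ 2)%:E <= c%:E)%E ->
  P.-integrable setT (fun w => (X w ^+ 2)%:E).
Proof.
move=> mX Xc; apply/integrableP; split.
  by apply/measurable_EFinP; exact: measurable_funX.
under eq_integral do rewrite gee0_abs ?lee_fin ?sqr_ge0 //.
exact: le_lt_trans Xc (ltry _).
Qed.

Lemma integrable_of_sqr (X : T -> R) (c : R) : measurable_fun [set: T] X ->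
  (\int[P]_w (X w ^+ 2)%:E <= c%:E)%E ->
  P.-integrable setT (fun w => (X w)%:E).
Proof.
move=> mX Xc; have iX := integrable_sqr mX Xc.
have i1 : P.-integrable setT (fun w => (1 + X w ^+ 2)%:E).
  under eq_fun do rewrite EFinD.
  apply: integrableD => //.
  exact: finite_measure_integrable_cst.
apply: (le_integrable _ _ _ i1) => //; first exact/measurable_EFinP.
move=> w _; rewrite /= lee_fin (ger0_norm (addr_ge0 ler01 (sqr_ge0 _))).
rewrite -[X in _ <= _ + X]real_normK ?num_real //.
have := sqr_ge0 (`|X w| - 1); have := normr_ge0 (X w); nra.
Qed.

Lemma integrable_bounded_mul (Z X : T -> R) (K : R) :
  measurable_fun [set: T] Z -> (forall w, `|Z w| <= K) ->
  P.-integrable setT (fun w => (X w)%:E) ->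
  P.-integrable setT (fun w => (Z w * X w)%:E).
Proof.
move=> mZ ZK iX.
have mX : measurable_fun [set: T] X.
  by apply/measurable_EFinP; exact: measurable_int iX.
have iK : P.-integrable setT (fun w => (K * X w)%:E).
  by under eq_fun do rewrite EFinM; exact: integrableZl.
apply: (le_integrable _ _ _ iK) => //.
  by apply/measurable_EFinP; exact: measurable_funM.
move=> w _; rewrite /= lee_fin !normrM ler_wpM2r //.
exact: le_trans (ZK w) (ler_norm _).
Qed.

Lemma measurable_norm_ge (X : T -> R) (e : R) : measurable_fun [set: T] X ->
  measurable [set w | e <= `|X w|].
Proof.
move=> mX; have : measurable_fun [set: T] (fun w => `|X w|) by exact: measurableT_comp.
move=> /(_ measurableT _ (measurable_itv `[e, +oo[)); rewrite setTI.
rewrite (_ : _ @^-1` _ = [set w | e <= `|X w|]) //.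
by apply/seteqP; split => w /=; rewrite in_itv /= andbT.
Qed.

Lemma chebyshev_sqr (X : T -> R) (e : R) : 0 < e -> measurable_fun [set: T] X ->
  ((e ^+ 2)%:E * P [set w | (e <= `|X w|)%R] <= \int[P]_w (X w ^+ 2)%:E)%E.
Proof.
move=> e0 mX.
have mA := measurable_norm_ge e mX.
rewrite -integral_cst //.
have mX2 : measurable_fun [set: T] (fun w => (X w ^+ 2)%:E).
  by apply/measurable_EFinP; exact: measurable_funX.
apply: (@le_trans _ _ (\int[P]_(w in [set w | (e <= `|X w|)%R]) (X w ^+ 2)%:E)%E).
  apply: ge0_le_integral => //.
  - by move=> w _ /=; rewrite lee_fin exprn_ge0 // ltW.
  - exact: measurable_funTS.
  - move=> w /= ew; rewrite lee_fin -[X in _ <= X]real_normK ?num_real //.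
    by rewrite lerXn2r ?nnegrE // ltW.
apply: ge0_subset_integral => //.
by move=> w _; rewrite lee_fin sqr_ge0.
Qed.

End second_moment.

Section martingale_differences.
Context {R : realType} {d : measure_display} {T : measurableType d}.
Variable P : probability T R.
Variables (S : nat -> set (set T)).
Hypothesis S_meas : forall n, <<s S n >> `<=` measurable.
Hypothesis S_mono : forall n, <<s S n >> `<=` <<s S n.+1 >>.

(** Orthogonality to the bounded multipliers adapted to [S n] expresses that [D n] has mean zero
    given [S n], without a conditional expectation. *)
Definition mart_diff (D : nat -> T -> R) (b : nat -> R) : Prop :=
  [/\ forall n, adapted (S n.+1) (D n),
      forall n, (\int[P]_w (D n w ^+ 2)%:E <= (b n)%:E)%E &
      forall n (Z : T -> R) (K : R), adapted (S n) Z -> (forall w, `|Z w| <= K) ->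
        (\int[P]_w (Z w * D n w)%:E = 0)%E].

(* Freezing the sums keeps the multipliers of the differences bounded, so that
   orthogonality to bounded functions suffices. *)
Fixpoint stopped_sum (D : nat -> T -> R) (e : R) (n : nat) (w : T) : R :=
  if n is n'.+1 then
    if `|stopped_sum D e n' w| < e then stopped_sum D e n' w + D n' w
    else stopped_sum D e n' w
  else 0.

(** A stopped sum below [e] has never been frozen. Contrapositively, once some partial sum has
    reached [e], so has the stopped sum, and a bound at one time controls all earlier times. *)
Lemma stopped_sumE D e n w : `|stopped_sum D e n w| < e ->
  stopped_sum D e n w = series (D ^~ w) n /\
  forall k, (k <= n)%N -> `|series (D ^~ w) k| < e.
Proof.
elim: n => [|n IH] /= h.
  have -> : series (D ^~ w) 0 = 0 by rewrite /series /= big_geq.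
  split => // k; rewrite leqn0 => /eqP ->.
  by rewrite /series /= big_geq.
move: h; case: ifPn => [s|/negP s h]; last by [].
have [e1 e2] := IH s; rewrite e1 -seriesS => h; split => // k.
by rewrite leq_eqVlt => /predU1P[->//|]; rewrite ltnS; exact: e2.
Qed.

Lemma stopped_sum_freeze D e n w : e <= `|stopped_sum D e n w| ->
  e <= `|stopped_sum D e n.+1 w|.
Proof. by move=> /= h; rewrite ltNge h. Qed.

Lemma stopped_sum_adapted D b e n : mart_diff D b ->
  adapted (S n) (stopped_sum D e n).
Proof.
move=> [aD _ _]; elim: n => [|n IH]; first exact: measurable_cst.
have IH' : adapted (S n.+1) (stopped_sum D e n) by exact: adapted_sub IH.
apply: measurable_fun_ifT => //.
  by apply: measurable_fun_ltr => //; exact: measurableT_comp.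
by apply: measurable_funD => //; exact: aD.
Qed.

Lemma stopped_sum_sqr D b e n : mart_diff D b ->
  (\int[P]_w (stopped_sum D e n w ^+ 2)%:E <= (series b n)%:E)%E.
Proof.
move=> md; have [aD bD oD] := md; elim: n => [|n IH].
  under eq_integral do rewrite /= expr0n.
  by rewrite integral0 /series /= big_geq.
have as_ k : adapted (S k) (stopped_sum D e k) by exact: stopped_sum_adapted md.
have ms k : measurable_fun [set: T] (stopped_sum D e k).
  exact: adapted_measurable (@S_meas k) (as_ k).
have mD : measurable_fun [set: T] (D n).
  exact: adapted_measurable (@S_meas n.+1) (aD n).
(* Where the sum is not frozen it is below [e], so [Z] is bounded by [2 * e]. *)
pose Z w := if `|stopped_sum D e n w| < e then 2 * stopped_sum D e n w else 0.
have aZ : adapted (S n) Z.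
  apply: measurable_fun_ifT => //.
    by apply: measurable_fun_ltr => //; apply: measurableT_comp => //; exact: as_.
  by apply: measurable_funM => //; exact: as_.
have ZK w : `|Z w| <= `|2 * e|.
  rewrite /Z; case: ifPn => [h|_]; last by rewrite normr0.
  by rewrite !normrM ler_wpM2l // (le_trans (ltW h)) // ler_norm.
have mZ : measurable_fun [set: T] Z by exact: adapted_measurable (@S_meas n) aZ.
have iD2 := integrable_sqr mD (bD n).
have iD := integrable_of_sqr mD (bD n).
have iZD := integrable_bounded_mul mZ ZK iD.
have is2 := integrable_sqr (ms n) IH.
have iZD2 : P.-integrable setT (fun w => ((Z w * D n w)%:E + (D n w ^+ 2)%:E)%E).
  exact: integrableD.
rewrite seriesS EFinD.
apply: (@le_trans _ _ (\int[P]_w ((stopped_sum D e n w ^+ 2)%:E +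
    ((Z w * D n w)%:E + (D n w ^+ 2)%:E)))%E); last first.
  rewrite integralD // integralD // (oD n Z `|2 * e|) // add0e.
  by apply: leeD.
have i3 : P.-integrable setT (fun w => ((stopped_sum D e n w ^+ 2)%:E +
    ((Z w * D n w)%:E + (D n w ^+ 2)%:E))%E) by exact: integrableD.
have pw w : stopped_sum D e n.+1 w ^+ 2 <=
  stopped_sum D e n w ^+ 2 + (Z w * D n w + D n w ^+ 2).
  rewrite /= /Z; case: ifPn => _; first by nra.
  by rewrite mul0r add0r lerDl sqr_ge0.
apply: ge0_le_integral => //.
- by move=> w _; rewrite lee_fin sqr_ge0.
- by apply/measurable_EFinP; exact: measurable_funX.
- exact: measurable_int i3.
- by move=> w _; rewrite -!EFinD lee_fin.
Qed.

(** Frozen sums stay frozen, so the events that the stopped sum has reached [e] by time [n] increase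
    with [n]. Chebyshev's inequality bounds each of them, and the bound passes to their union. *)
Lemma mart_diff_maximal D b e c : mart_diff D b -> 0 < e ->
  (forall n, series b n <= c) ->
  exists B, [/\ measurable B, ((e ^+ 2)%:E * P B <= c%:E)%E &
    forall w n, e <= `|series (D ^~ w) n| -> B w].
Proof.
move=> md e0 bc.
pose F n := [set w | e <= `|stopped_sum D e n w|].
have ms n : measurable_fun [set: T] (stopped_sum D e n).
  by apply: (adapted_measurable (@S_meas n)); exact: stopped_sum_adapted md.
have mF n : measurable (F n) by exact: measurable_norm_ge.
have mUF : measurable (\bigcup_n F n) by exact: bigcupT_measurable.
exists (\bigcup_n F n); split => //; last first.
  move=> w n hn; exists n => //; rewrite /F /= leNgt; apply/negP => h.
  by have [_ /(_ n (leqnn n))] := stopped_sumE h; rewrite ltNge hn.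
have ndF : nondecreasing_seq F.
  by apply/nondecreasing_seqP => n; apply/subsetPset => w; exact: stopped_sum_freeze.
have e20 : 0 < e ^+ 2 by rewrite exprn_gt0.
have PF n : (P (F n) <= (c / e ^+ 2)%:E)%E.
  have h := le_trans (chebyshev_sqr P e0 (ms n)) (stopped_sum_sqr e n md).
  have {}h : ((e ^+ 2)%:E * P (F n) <= c%:E)%E by apply: le_trans h _; rewrite lee_fin.
  have Pfin : P (F n) \is a fin_num by exact: fin_num_measure.
  rewrite -(fineK Pfin) -EFinM lee_fin in h.
  by rewrite -(fineK Pfin) lee_fin ler_pdivlMr // mulrC.
have : (P (\bigcup_n F n) <= (c / e ^+ 2)%:E)%E.
  have cv := nondecreasing_cvg_mu (mu := P) mF mUF ndF.
  rewrite -(cvg_lim _ cv) //; apply: lime_le.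
    by apply/cvg_ex; eexists; exact: cv.
  by near=> n; exact: PF.
have Pfin : P (\bigcup_n F n) \is a fin_num by exact: fin_num_measure.
by rewrite -(fineK Pfin) -EFinM !lee_fin ler_pdivlMr // mulrC.
Unshelve. all: end_near. Qed.

(** With the first [m] differences erased, the maximal inequality bounds the oscillation of the
    series after [m]. *)
Lemma mart_diff_tail D b m : mart_diff D b ->
  mart_diff (fun n w => if (n < m)%N then 0 else D n w)
            (fun n => if (n < m)%N then 0 else b n).
Proof.
move=> [aD bD oD]; split => n.
- by have [nm|nm] := ltnP n m; [exact: measurable_cst | exact: aD].
- have [nm|nm] := ltnP n m; last exact: bD.
  by under eq_integral do rewrite expr0n; rewrite integral0.
- have [nm|nm] := ltnP n m; last exact: oD.
  by move=> Z K _ _; under eq_integral do rewrite mulr0; rewrite integral0.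
Qed.

Lemma series_tail (f : nat -> R) m n :
  series (fun k => if (k < m)%N then 0 else f k) n =
  if (n <= m)%N then 0 else series f n - series f m.
Proof.
elim: n => [|n IH]; first by rewrite /series /= big_geq.
rewrite seriesS IH; have [nm|mn] := ltnP n m; first by rewrite ltnW // addr0.
rewrite leq_eqVlt; case: eqVneq => [->|nm] /=.
  by rewrite seriesS add0r addrAC subrr add0r.
by rewrite ltnNge mn /= seriesS addrAC.
Qed.

(** A partial-sum sequence that is not Cauchy oscillates by some [eps i] after every [m]. The
    maximal inequality for late tails, whose second moments have arbitrarily small sums, covers this
    event by sets of arbitrarily small probability. *)
Theorem mart_diff_cvg D b : mart_diff D b -> (forall n, 0 <= b n) ->
  cvgn (series b) -> {ae P, forall w, cvgn (series (D ^~ w))}.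
Proof.
move=> md b0 cb.
pose eps (i : nat) : R := i.+1%:R^-1.
have eps0 i : 0 < eps i by rewrite invr_gt0.
pose Bad i := [set w | forall m, exists2 n, (m <= n)%N &
   eps i <= `|series (D ^~ w) n - series (D ^~ w) m|].
have negl i : P.-negligible (Bad i).
  have H (k : nat) : exists B, [/\ measurable B, (P B <= (k.+1%:R^-1)%:E)%E & Bad i `<=` B].
    (* The factor [eps i ^+ 2] is the one by which the maximal inequality divides; [k.+1%:R^-1]
       remains. *)
    pose c : R := k.+1%:R^-1 * eps i ^+ 2.
    have c0 : 0 < c by rewrite mulr_gt0 ?exprn_gt0 // invr_gt0.
    have [m hm] := cvgn_near_cauchy cb c0.
    have [n|B [mB PB hB]] := mart_diff_maximal (mart_diff_tail m md) (eps0 i) (c := c).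
      rewrite series_tail; case: leqP => [_|mn]; first exact: ltW.
      have := hm n m (ltnW mn) (leqnn m).
      by rewrite ltr_norml => /andP[_ /ltW].
    exists B; split => //.
      have Pfin : P B \is a fin_num by exact: fin_num_measure.
      move: PB; rewrite -(fineK Pfin) -EFinM !lee_fin /c mulrC.
      by rewrite ler_pM2r // exprn_gt0.
    move=> w /(_ m)[n mn hn]; apply: (hB w n).
    rewrite (series_tail (D ^~ w)); case: leqP => // nm.
    have nE : n = m by apply/eqP; rewrite eqn_leq nm mn.
    by move: hn; rewrite nE subrr normr0.
  have /choice[B hB] := H.
  exists (\bigcap_k B k); split.
  - by apply: bigcapT_measurable => k; have [] := hB k.
  - apply/eqP; rewrite eq_le measure_ge0 andbT.
    apply/lee_addgt0Pr => e e0; rewrite add0e.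
    have [k ke] := inv_nat_lt e0.
    have [mB PB _] := hB k.
    apply: (le_trans _ (le_trans PB _)); last by rewrite lee_fin ltW.
    apply: le_measure; rewrite ?inE //; last by move=> w; apply.
    by apply: bigcapT_measurable => j; have [] := hB j.
  - by move=> w wB k _; have [_ _] := hB k; apply.
have := negligible_bigcup negl; apply: negligibleS => w /= ncv.
apply: contrapT => nB; apply: ncv; apply/cauchy_cvgP/cauchy_ballP => e e0.
have [i ie] : exists i, eps i < e / 2 by apply: inv_nat_lt; rewrite divr_gt0.
have [m hm] : exists m, forall n, (m <= n)%N ->
    `|series (D ^~ w) n - series (D ^~ w) m| < eps i.
  apply: contrapT => hno; apply: nB; exists i => // m.
  apply: contrapT => hno2; apply: hno; exists m => n mn.
  by rewrite ltNge; apply/negP => h; apply: hno2; exists n.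
exists ([set x | `|x - series (D ^~ w) m| < e / 2],
        [set x | `|x - series (D ^~ w) m| < e / 2]).
  by split; exists m => // n /= mn; apply: lt_trans ie; exact: hm.
move=> [x y] /= [hx hy]; rewrite /ball /=.
have := ler_normB (x - series (D ^~ w) m) (y - series (D ^~ w) m).
rewrite opprB addrA subrK; lra.
Qed.

End martingale_differences.

(** * Independent samples *)

Section variance.
Context {R : realType} {d : measure_display} {T : measurableType d}.
Variable P : probability T R.

(** The variance identity. Dropping one or the other term on the left bounds the squared mean and
    the centered second moment. *)
Lemma integral_sqr_center (X : T -> R) (c : R) : measurable_fun [set: T] X ->
  (\int[P]_w (X w ^+ 2)%:E <= c%:E)%E ->
  let m := fine (\int[P]_w (X w)%:E) in
  ((\int[P]_w ((X w - m) ^+ 2)%:E) + (m ^+ 2)%:E = \int[P]_w (X w ^+ 2)%:E)%E.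
Proof.
move=> mX Xc m.
have iX2 := integrable_sqr mX Xc; have iX := integrable_of_sqr mX Xc.
have im : P.-integrable setT (fun w => (- (m *+ 2) * X w)%:E).
  by under eq_fun do rewrite EFinM; exact: integrableZl.
have ic : P.-integrable setT (fun w => (m ^+ 2)%:E) by exact: finite_measure_integrable_cst.
have E1 : (\int[P]_w ((X w - m) ^+ 2)%:E = \int[P]_w ((X w ^+ 2)%:E +
    ((- (m *+ 2) * X w)%:E + (m ^+ 2)%:E)))%E.
  by apply: eq_integral => w _; rewrite -!EFinD; congr EFin; ring.
have Xm : (\int[P]_w (X w)%:E = m%:E)%E.
  by rewrite fineK //; exact: integrable_fin_num.
rewrite E1 integralD //; last exact: integrableD.
rewrite integralD //.
under [X in (_ + (X + _) + _)%E]eq_integral do rewrite EFinM.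
rewrite integralZl // Xm integral_cst //= probability_setT mule1.
rewrite -EFinM -EFinD -addeA -EFinD -[RHS]adde0; congr (_ + _)%E.
by congr EFin; ring.
Qed.

Lemma mean_sqr_le (X : T -> R) (c : R) : measurable_fun [set: T] X ->
  (\int[P]_w (X w ^+ 2)%:E <= c%:E)%E ->
  fine (\int[P]_w (X w)%:E) ^+ 2 <= c.
Proof.
move=> mX Xc; rewrite -lee_fin; apply: (le_trans _ Xc).
rewrite -(integral_sqr_center mX Xc) leeDr //.
by apply: integral_ge0 => w _; rewrite lee_fin sqr_ge0.
Qed.

Lemma centered_sqr_le (X : T -> R) (c : R) : measurable_fun [set: T] X ->
  (\int[P]_w (X w ^+ 2)%:E <= c%:E)%E ->
  (\int[P]_w ((X w - fine (\int[P]_w (X w)%:E)) ^+ 2)%:E <= c%:E)%E.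
Proof.
move=> mX Xc; apply: (le_trans _ Xc).
by rewrite -(integral_sqr_center mX Xc) leeDl // lee_fin sqr_ge0.
Qed.

Lemma nneseries_cvgn (x : nat -> R) : (forall n, 0 <= x n) ->
  (\sum_(0 <= n <oo) (x n)%:E < +oo)%E -> cvgn (series x).
Proof.
move=> x0 xoo; apply: nondecreasing_is_cvgn; first exact: series_mono.
have fin : (\sum_(0 <= n <oo) (x n)%:E)%E \is a fin_num.
  by rewrite ge0_fin_numE // nneseries_ge0 // => n _ _; rewrite lee_fin.
exists (fine (\sum_(0 <= n <oo) (x n)%:E)%E) => _ [n _ <-].
rewrite -lee_fin fineK // /series /= -sumEFin.
by apply: nneseries_lim_ge => k _ _; rewrite lee_fin.
Qed.

Lemma cvgn_nneseries (x : nat -> R) : (forall n, 0 <= x n) ->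
  cvgn (series x) -> (\sum_(0 <= n <oo) (x n)%:E < +oo)%E.
Proof.
move=> x0 cx; apply: (@le_lt_trans _ _ (limn (series x))%:E); last exact: ltry.
apply: lime_le.
  by apply: is_cvg_nneseries => n _ _; rewrite lee_fin.
near=> n; rewrite sumEFin lee_fin.
exact: nondecreasing_cvgn_le (series_mono x0) cx n.
Unshelve. all: end_near. Qed.

(** Sum and integral may be exchanged by nonnegativity; the sum is thus integrable, hence finite
    almost everywhere. *)
Lemma ae_cvgn_series (X : nat -> T -> R) (b : nat -> R) :
  (forall n, measurable_fun [set: T] (X n)) -> (forall n w, 0 <= X n w) ->
  (forall n, (\int[P]_w (X n w)%:E <= (b n)%:E)%E) -> (forall n, 0 <= b n) ->
  cvgn (series b) -> {ae P, forall w, cvgn (series (X ^~ w))}.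
Proof.
move=> mX X0 Xb b0 cb.
have mXE n : measurable_fun [set: T] (fun w => (X n w)%:E) by exact/measurable_EFinP.
have iS : P.-integrable setT (fun w => (\sum_(0 <= n <oo) (X n w)%:E)%E).
  apply/integrableP; split.
    apply: ge0_emeasurable_sum => // n w _ _; by rewrite lee_fin.
  rewrite (eq_integral (fun w => (\sum_(0 <= n <oo) (X n w)%:E)%E)); last first.
    move=> w _; rewrite gee0_abs // nneseries_ge0 // => n _ _.
    by rewrite lee_fin.
  rewrite integral_nneseries //; last by move=> n w _; rewrite lee_fin.
  apply: le_lt_trans (cvgn_nneseries b0 cb).
  apply: lee_nneseries => // n _ _.
  by apply: integral_ge0 => w _; rewrite lee_fin.
have := integrable_ae measurableT iS.
apply: filterS => w /(_ I) fin; apply: nneseries_cvgn => //.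
by rewrite -ge0_fin_numE // nneseries_ge0 // => n _ _; rewrite lee_fin.
Qed.

End variance.

(** * Integration over the past and over a fresh sample separately *)

Section independent_sigma_algebras.
Context {R : realType} {d : measure_display} {T : measurableType d}.
Variable P : probability T R.
Variables S1 S2 : set (set T).
Hypothesis S1m : <<s S1 >> `<=` measurable.
Hypothesis S2m : <<s S2 >> `<=` measurable.
Hypothesis S12 : forall A B, <<s S1 >> A -> <<s S2 >> B ->
  P (A `&` B) = (P A * P B)%E.

Notation T1 := (g_sigma_algebraType S1).
Notation T2 := (g_sigma_algebraType S2).

Let to1 (w : T) : T1 := w.
Let to2 (w : T) : T2 := w.
Let diag (w : T) : T1 * T2 := (w, w).

Let m1 : measurable_fun [set: T] to1.
Proof. by move=> _ Y mY; rewrite setTI; exact: S1m. Qed.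

Let m2 : measurable_fun [set: T] to2.
Proof. by move=> _ Y mY; rewrite setTI; exact: S2m. Qed.

Let mdiag : measurable_fun [set: T] diag.
Proof. exact: measurable_fun_pair. Qed.

HB.instance Definition _ := isMeasurableFun.Build _ _ _ _ to1 m1.
HB.instance Definition _ := isMeasurableFun.Build _ _ _ _ to2 m2.
HB.instance Definition _ := isMeasurableFun.Build _ _ _ _ diag mdiag.

Let P1 : probability T1 R := distribution P to1.
Let P2 : probability T2 R := distribution P to2.

(** The inverse image of a rectangle [A] x [B] under the diagonal map is the intersection of [A] and
    [B]. Independence therefore makes the image of [P] agree with the product measure on rectangles,
    hence everywhere. *)
Let prodE X : measurable X -> (P1 \x P2)%E X = pushforward P diag X.
Proof.
apply: product_measure_unique => A B mA mB.
by rewrite -S12.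
Qed.

Let integral_prodE (H : T1 * T2 -> \bar R) :
  (\int[P1 \x P2]_z H z = \int[pushforward P diag]_z H z)%E.
Proof. by apply: eq_measure_integral => A mA _; exact: prodE. Qed.

Let section2 (H : T1 * T2 -> \bar R) x : measurable_fun setT H ->
  measurable_fun [set: T2] (fun y => H (x, y)).
Proof. by move=> mH; exact: measurableT_comp. Qed.

Lemma indep_tonelli (H : T1 * T2 -> \bar R) : measurable_fun setT H ->
  (forall z, 0 <= H z)%E ->
  (\int[P]_w H (w, w) = \int[P]_w \int[P]_w' H (w, w'))%E.
Proof.
move=> mH H0.
transitivity (\int[P1 \x P2]_z H z)%E.
  by rewrite integral_prodE ge0_integral_pushforward.
rewrite fubini_tonelli1 //.
rewrite (@ge0_integral_pushforward _ _ _ _ R to1 m1 P) //; last first.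
- by move=> x _; exact: integral_ge0.
- exact: measurable_fun_fubini_tonelli_F.
apply: eq_integral => w _ /=; rewrite /fubini_F.
by rewrite (@ge0_integral_pushforward _ _ _ _ R to2 m2 P) //; exact: section2.
Qed.

(** The partial integral serves as the mean given [<<s S1 >>] and has to be measurable for it.
    Tonelli's theorem yields this for nonnegative functions, whence the splitting into two parts. *)
Lemma partial_integral_adapted (H : T1 * T2 -> \bar R) : measurable_fun setT H ->
  measurable_fun [set: T1] (fun w => \int[P]_w' H (w, w'))%E.
Proof.
have pos (f : T1 * T2 -> \bar R) : measurable_fun setT f -> (forall z, 0 <= f z)%E ->
    measurable_fun [set: T1] (fun w => \int[P]_w' f (w, w'))%E.
  move=> mf f0; have := @measurable_fun_fubini_tonelli_F _ _ _ _ R P2 f mf f0.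
  rewrite (_ : fubini_F _ _ = fun w => \int[P]_w' f (w, w'))%E //.
  apply/funext => x; rewrite /fubini_F.
  by rewrite (@ge0_integral_pushforward _ _ _ _ R to2 m2 P) //; exact: section2.
move=> mH.
rewrite (_ : (fun w => _) = (fun w => \int[P]_w' H^\+ (w, w') - \int[P]_w' H^\- (w, w'))%E).
  apply: emeasurable_funB; apply: pos => //.
  - exact: measurable_funepos.
  - exact: measurable_funeneg.
apply/funext => w; rewrite integralE; congr (_ - _)%E.
  by apply: eq_integral => w' _; rewrite !funeposE.
by apply: eq_integral => w' _; rewrite !funenegE.
Qed.

(** Fubini turns the integral over the diagonal into an iterated one whose inner integrals all
    vanish. *)
Lemma indep_center (H : T1 * T2 -> \bar R) : measurable_fun setT H ->
  P.-integrable setT (fun w => H (w, w)) ->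
  (forall w, P.-integrable setT (fun w' => H (w, w'))) ->
  (forall w, \int[P]_w' H (w, w') = 0)%E ->
  (\int[P]_w H (w, w) = 0)%E.
Proof.
move=> mH iH iHw Hw0.
have ip : (P1 \x P2)%E.-integrable setT H.
  apply/integrableP; split => //; rewrite integral_prodE.
  rewrite ge0_integral_pushforward //; last exact: measurableT_comp.
  by have /integrableP[] := iH.
transitivity (\int[P1 \x P2]_z H z)%E.
  by rewrite integral_prodE integral_pushforward.
rewrite -integral12_prod_meas1 //.
rewrite (eq_integral (cst 0%E)) ?integral0 // => x _; rewrite /fubini_F.
rewrite (@integral_pushforward _ _ _ _ R to2 m2 P) //; first exact: Hw0.
- exact: section2.
- exact: iHw.
Qed.

End independent_sigma_algebras.

(** * Almost sure convergence of the centered and of the squared noise *)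

Section noise.
Context {R : realType} {d : measure_display} {T : measurableType d}.
Variable P : probability T R.
Variables S Q : nat -> set (set T).
Hypothesis S_meas : forall n, <<s S n >> `<=` measurable.
Hypothesis S_mono : forall n, <<s S n >> `<=` <<s S n.+1 >>.
Hypothesis QS : forall n, <<s Q n >> `<=` <<s S n.+1 >>.
Hypothesis SQ_indep : forall n A B, <<s S n >> A -> <<s Q n >> B ->
  P (A `&` B) = (P A * P B)%E.

(** In [k n w w'] the first point carries the past and the second the fresh sample. The observed
    quantity is the diagonal value [k n w w]; its mean given the past is the integral over [w']. *)
Definition kernel_measurable (k : nat -> T -> T -> R) : Prop := forall n,
  measurable_fun
    [set: (g_sigma_algebraType (S n) * g_sigma_algebraType (Q n))%type]
    (fun z => k n z.1 z.2).

Let Q_meas n : <<s Q n >> `<=` measurable.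
Proof. exact: subset_trans (@QS n) (@S_meas n.+1). Qed.

Lemma kernel_diag k n : kernel_measurable k -> adapted (S n.+1) (fun w => k n w w).
Proof.
move=> mk.
have mid : measurable_fun [set: g_sigma_algebraType (S n.+1)]
    (fun w : T => ((w : g_sigma_algebraType (S n)), (w : g_sigma_algebraType (Q n)))).
  apply: measurable_fun_pair => _ Y mY; rewrite setTI; first exact: S_mono.
  exact: QS.
exact: (measurableT_comp (mk n) mid).
Qed.

Lemma kernel_section k n w : kernel_measurable k -> measurable_fun [set: T] (k n w).
Proof.
move=> mk; apply: (@adapted_measurable _ _ _ (Q n)) => //.
have mid : measurable_fun [set: g_sigma_algebraType (Q n)]
    (fun w' : g_sigma_algebraType (Q n) => ((w : g_sigma_algebraType (S n)), w')).
  exact: measurable_fun_pair.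
exact: (measurableT_comp (mk n) mid).
Qed.

Lemma kernel_diag_sqr k n c : kernel_measurable k ->
  (forall n w, \int[P]_w' (k n w w' ^+ 2)%:E <= c%:E)%E ->
  (\int[P]_w (k n w w ^+ 2)%:E <= c%:E)%E.
Proof.
move=> mk kc.
rewrite (@indep_tonelli _ _ _ P (S n) (Q n) (@S_meas n) (@Q_meas n) (@SQ_indep n)
  (fun z => (k n z.1 z.2 ^+ 2)%:E)) /=; last 2 first.
- by apply/measurable_EFinP; apply: measurable_funX; exact: mk.
- by move=> z; rewrite lee_fin sqr_ge0.
apply: (@le_trans _ _ (\int[P]_w (cst c%:E w))%E).
  apply: ge0_le_integral => //.
  - by move=> w _; apply: integral_ge0 => w' _; rewrite lee_fin sqr_ge0.
  - have pm : measurable_fun [set: g_sigma_algebraType (S n)]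
        (fun w => \int[P]_w' (k n w w' ^+ 2)%:E)%E.
      apply: (@partial_integral_adapted _ _ _ P (S n) (Q n) (@Q_meas n)
        (fun z => (k n z.1 z.2 ^+ 2)%:E)) => //.
      by apply/measurable_EFinP; apply: measurable_funX; exact: mk.
    by move=> _ Y mY; apply: S_meas; exact: pm.
by rewrite integral_cst //= probability_setT mule1.
Qed.

(** Centering over [w'] makes the diagonal a martingale difference: a multiplier known from the past
    depends on the first point alone, so its product with the kernel stays centered and
    [indep_center] applies. The second moments are at most [c * t n ^+ 2]. *)
Theorem noise_cvg (k : nat -> T -> T -> R) (t : nat -> R) (c : R) :
  kernel_measurable k ->
  (forall n w, \int[P]_w' (k n w w' ^+ 2)%:E <= c%:E)%E ->
  cvgn (series (fun n => t n ^+ 2)) ->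
  {ae P, forall w, cvgn (series (fun n =>
     t n * (k n w w - fine (\int[P]_w' (k n w w')%:E))))}.
Proof.
move=> mk kc ct.
have c0 : 0 <= c.
  rewrite -lee_fin; apply: (le_trans _ (kc 0%N point)).
  by apply: integral_ge0 => w _; rewrite lee_fin sqr_ge0.
pose m n (w : T) := fine (\int[P]_w' (k n w w')%:E)%E.
pose h n (w w' : T) := k n w w' - m n w.
have mm n : adapted (S n) (m n).
  apply: measurableT_comp => //.
  apply: (@partial_integral_adapted _ _ _ P (S n) (Q n) (@Q_meas n)
        (fun z => (k n z.1 z.2)%:E)) => //.
  by apply/measurable_EFinP; exact: mk.
have mh : kernel_measurable h.
  move=> n; apply: measurable_funB; first exact: mk.
  exact: (measurableT_comp (mm n) measurable_fst).
have hc n w : (\int[P]_w' (h n w w' ^+ 2)%:E <= c%:E)%E.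
  exact: centered_sqr_le (@kernel_section k n w mk) (kc n w).
have hi n w : P.-integrable setT (fun w' => (h n w w')%:E).
  exact: integrable_of_sqr (@kernel_section h n w mh) (hc n w).
have h0 n w : (\int[P]_w' (h n w w')%:E = 0)%E.
  have ki := integrable_of_sqr (@kernel_section k n w mk) (kc n w).
  under eq_integral do rewrite EFinB.
  rewrite integralB //; last exact: finite_measure_integrable_cst.
  rewrite integral_cst //= probability_setT mule1 /m fineK ?subee //.
    exact: integrable_fin_num.
  exact: integrable_fin_num.
have hd n : (\int[P]_w (h n w w ^+ 2)%:E <= c%:E)%E by exact: kernel_diag_sqr.
have md : mart_diff P S (fun n w => t n * h n w w) (fun n => c * t n ^+ 2).
  split => n.
  - by apply: measurable_funM => //; exact: kernel_diag.
  - under eq_integral do rewrite exprMn EFinM.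
    rewrite ge0_integralZl //; last 3 first.
    + apply/measurable_EFinP; apply: measurable_funX.
      exact: adapted_measurable (@S_meas n.+1) (@kernel_diag h n mh).
    + by move=> w _; rewrite lee_fin sqr_ge0.
    + by rewrite lee_fin sqr_ge0.
    by rewrite (EFinM c) [leRHS]muleC lee_wpmul2l ?lee_fin ?sqr_ge0.
  - move=> Z K aZ ZK.
    have mZ : measurable_fun [set: T] Z by exact: adapted_measurable (@S_meas n) aZ.
    have hdm : measurable_fun [set: T] (fun w => h n w w).
      exact: adapted_measurable (@S_meas n.+1) (@kernel_diag h n mh).
    have ZtK w : `|Z w * t n| <= K * `|t n| by rewrite normrM ler_wpM2r.
    have mZt : measurable_fun [set: T] (fun w => Z w * t n) by exact: measurable_funM.
    under eq_integral do rewrite mulrA.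
    apply: (@indep_center _ _ _ P (S n) (Q n) (@S_meas n) (@Q_meas n) (@SQ_indep n)
      (fun z => (Z z.1 * t n * h n z.1 z.2)%:E)) => /=.
    + apply/measurable_EFinP; apply: measurable_funM; last exact: mh.
      by apply: measurable_funM => //; exact: (measurableT_comp aZ measurable_fst).
    + exact: integrable_bounded_mul mZt ZtK (integrable_of_sqr hdm (hd n)).
    + by move=> w; under eq_fun do rewrite EFinM; exact: integrableZl.
    + move=> w; under eq_integral do rewrite EFinM.
      by rewrite integralZl // h0 mule0.
apply: (mart_diff_cvg S_meas S_mono md) => [n|]; first by rewrite mulr_ge0 // sqr_ge0.
rewrite [X in cvgn X](_ : _ = fun n => c * series (fun n => t n ^+ 2) n).
  exact: is_cvgMr.
by apply/funext => n; rewrite /series /= mulr_sumr.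
Qed.

Theorem diag_sqr_cvg (k : nat -> T -> T -> R) (t : nat -> R) (c : R) :
  kernel_measurable k ->
  (forall n w, \int[P]_w' (k n w w' ^+ 2)%:E <= c%:E)%E ->
  cvgn (series (fun n => t n ^+ 2)) ->
  {ae P, forall w, cvgn (series (fun n => (t n * k n w w) ^+ 2))}.
Proof.
move=> mk kc ct.
have c0 : 0 <= c.
  rewrite -lee_fin; apply: (le_trans _ (kc 0%N point)).
  by apply: integral_ge0 => w _; rewrite lee_fin sqr_ge0.
have kd n : (\int[P]_w (k n w w ^+ 2)%:E <= c%:E)%E by exact: kernel_diag_sqr.
apply: (@ae_cvgn_series _ _ _ P _ (fun n => c * t n ^+ 2)).
- move=> n; apply: measurable_funX; apply: measurable_funM => //.
  exact: adapted_measurable (@S_meas n.+1) (@kernel_diag k n mk).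
- by move=> n w; exact: sqr_ge0.
- move=> n; under eq_integral do rewrite exprMn EFinM.
  rewrite ge0_integralZl //; last 3 first.
  + apply/measurable_EFinP; apply: measurable_funX.
    exact: adapted_measurable (@S_meas n.+1) (@kernel_diag k n mk).
  + by move=> w _; rewrite lee_fin sqr_ge0.
  + by rewrite lee_fin sqr_ge0.
  by rewrite (EFinM c) [leRHS]muleC lee_wpmul2l ?lee_fin ?sqr_ge0.
- by move=> n; rewrite mulr_ge0 // sqr_ge0.
rewrite [X in cvgn X](_ : _ = fun n => c * series (fun n => t n ^+ 2) n).
  exact: is_cvgMr.
by apply/funext => n; rewrite /series /= mulr_sumr.
Qed.

End noise.

(** * From generators to generated sigma-algebras *)

Section generated_sigma_algebras.

(** The sets whose inverse image lies in [Q] form a sigma-algebra containing [C]. *)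
Lemma preimage_generated (aT rT : Type) (f : aT -> rT) (Q : set (set aT))
    (C : set (set rT)) : sigma_algebra setT Q ->
  (forall B, C B -> Q (f @^-1` B)) -> forall B, <<s C >> B -> Q (f @^-1` B).
Proof.
move=> sQ CQ B CB.
have : image_set_system setT f Q B.
  apply: CB; split; first exact: sigma_algebra_image.
  by move=> A CA; rewrite /image_set_system /= setTI; exact: CQ.
by rewrite /image_set_system /= setTI.
Qed.

Lemma sigma_algebra_sigma_of (T : Type) (X : topologicalType) (f : T -> X) :
  sigma_algebra setT (sigma_of f).
Proof.
have := @sigma_algebra_preimage _ _ (borel X) setT f (@smallest_sigma_algebra _ setT _).
rewrite (_ : preimage_set_system _ _ _ = sigma_of f) //.
by apply/seteqP; split => _ [B bB <-]; exists B; rewrite ?setTI.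
Qed.

(** Traces on [D] commute with complements relative to [D] and with countable unions, so the sets
    admitting a witness form a sigma-algebra; open intervals generate the Borel sets. *)
Lemma measurable_on_measurable (R : realType) (T : Type) (S : set (set T))
    (D : set T) (f : T -> R) : sigma_algebra setT S -> measurable_on S D f ->
  forall Y : set R, measurable Y -> exists2 B, S B & D `&` f @^-1` Y = D `&` B.
Proof.
move=> [S0 SC SU] mf Y mY.
pose Q := [set Y : set R | exists2 B, S B & D `&` f @^-1` Y = D `&` B].
have : (@RGenOpens.G R).-sigma.-measurable Y by rewrite -RGenOpens.measurableE.
move=> /(_ Q); apply; split; first split.
- by exists set0 => //; rewrite preimage_set0.
- move=> A [B SB e]; exists (setT `\` B); first exact: SC.
  rewrite !setTD preimage_setC; apply/seteqP; split => x [Dx nx]; split => // Bx.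
    by have : (D `&` B) x by []; rewrite -e => -[].
  by have : (D `&` f @^-1` A) x by []; rewrite e => -[].
- move=> A hA.
  have /choice[B hB] : forall n, exists B, S B /\ D `&` f @^-1` (A n) = D `&` B.
    by move=> n; have [B] := hA n; exists B.
  exists (\bigcup_n B n); first by apply: SU => n; have [] := hB n.
  rewrite preimage_bigcup !setI_bigcupr; apply: eq_bigcup => // n _.
  by have [] := hB n.
- move=> _ [x [y ->]]; apply: mf; exact: interval_open.
Qed.

Lemma borel_prod_section (S T : topologicalType) (B : set (S * T)) (v : S) :
  borel_prod S T B -> borel T [set x | B (v, x)].
Proof.
apply: (@preimage_generated _ _ (fun x : T => (v, x))).
  exact: smallest_sigma_algebra.
move=> _ [A oA [A' oA' <-]].
have [Av|nAv] := pselect (A v).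
  rewrite (_ : _ @^-1` _ = A'); first exact: sub_sigma_algebra.
  by apply/seteqP; split => x //= [].
rewrite (_ : _ @^-1` _ = set0); first exact: sigma_algebra0.
by apply/seteqP; split => x //= [].
Qed.

End generated_sigma_algebras.

Section equal_laws.
Context {R : realType} {d : measure_display} {T : measurableType d}.
Variables (P : probability T R) (X Y : T -> R).
Hypothesis mX : measurable_fun [set: T] X.
Hypothesis mY : measurable_fun [set: T] Y.
Hypothesis XY : forall A : set R, measurable A -> P (X @^-1` A) = P (Y @^-1` A).

Lemma eq_law_ge0 (f : R -> \bar R) : measurable_fun setT f ->
  (forall x, 0 <= f x)%E -> (\int[P]_w f (X w) = \int[P]_w f (Y w))%E.
Proof.
move=> mf f0.
transitivity (\int[pushforward P X]_x f x)%E.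
  by rewrite (@ge0_integral_pushforward _ _ _ _ R X mX P).
transitivity (\int[pushforward P Y]_x f x)%E; last first.
  by rewrite (@ge0_integral_pushforward _ _ _ _ R Y mY P).
by apply: eq_measure_integral => A mA _; exact: XY.
Qed.

Lemma eq_law_integral : (\int[P]_w (X w)%:E = \int[P]_w (Y w)%:E)%E.
Proof.
have mE : measurable_fun [set: R] (@EFin R) by exact: EFin_measurable.
rewrite integralE [RHS]integralE; congr (_ - _)%E.
  have posE (Z : T -> R) : (fun w => (Z w)%:E)^\+%E = (fun w => (@EFin R)^\+%E (Z w)).
    by apply/funext => w; rewrite !funeposE.
  by rewrite !posE (eq_law_ge0 (measurable_funepos mE) (funepos_ge0 _)).
have negE (Z : T -> R) : (fun w => (Z w)%:E)^\-%E = (fun w => (@EFin R)^\-%E (Z w)).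
  by apply/funext => w; rewrite !funenegE.
by rewrite !negE (eq_law_ge0 (measurable_funeneg mE) (funeneg_ge0 _)).
Qed.

End equal_laws.

(** * Noise series of functions of the iterate and the sample *)

Section samples.
Context {R : realType} {U : topologicalType}.
Context {d : measure_display} {Omega : measurableType d}.
Variable P : probability Omega R.
Context {m : nat}.
Variables (Xi : set 'rV[R]_m) (xi : Omega -> 'rV[R]_m).
Hypothesis xi_meas : measurable_wrt measurable xi.
Hypothesis xi_Xi : forall w, Xi (xi w).
Variables (zeta : nat -> Omega -> 'rV[R]_m) (F : nat -> set (set Omega)).
Variable u : nat -> Omega -> U.
Hypothesis zeta_meas : forall n, measurable_wrt measurable (zeta n).
Hypothesis zeta_Xi : forall n w, Xi (zeta n w).
Hypothesis zeta_distr : forall n B, borel 'rV[R]_m B ->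
  P (zeta n @^-1` B) = P (xi @^-1` B).
Hypothesis F_filt : filtration F.
Hypothesis zeta_indep : forall n,
  indep_sigma P (sigma_of (zeta n)) (past F zeta n).
Hypothesis u_adapted : forall n, measurable_wrt (F n) (u n).
Variable V : set U.
Hypothesis V_open : open V.

Let S n : set (set Omega) :=
  F n `|` \bigcup_(k in [set k | (k < n)%N]) sigma_of (zeta k).
Let Q n : set (set Omega) := sigma_of (zeta n).

Let QE n : <<s Q n >> = Q n.
Proof. exact/sigma_algebra_id/sigma_algebra_sigma_of. Qed.

Lemma measurable_sample (f : Omega -> 'rV[R]_m) : measurable_wrt measurable f ->
  forall B, borel 'rV[R]_m B -> measurable (f @^-1` B).
Proof.
move=> mf; apply: preimage_generated => //; exact: sigma_algebra_measurable.
Qed.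

Let S_meas n : <<s S n >> `<=` measurable.
Proof.
apply: smallest_sub; first exact: sigma_algebra_measurable.
move=> A [FA|[k _ [B bB <-]]]; first by have [_ h _] := F_filt; exact: (h n).
exact: measurable_sample (@zeta_meas k) _ bB.
Qed.

Let S_mono n : <<s S n >> `<=` <<s S n.+1 >>.
Proof.
apply: sub_smallest2r; first exact: smallest_sigma_algebra.
move=> A [FA|[k kn sA]]; first by left; have [_ _ h] := F_filt; exact: (h n).
by right; exists k => //=; exact: ltnW.
Qed.

Let QS n : <<s Q n >> `<=` <<s S n.+1 >>.
Proof. by rewrite QE => A QA; apply: sub_sigma_algebra; right; exists n => //=. Qed.

Let SQ_indep n A B : <<s S n >> A -> <<s Q n >> B -> P (A `&` B) = (P A * P B)%E.
Proof. by rewrite QE => SA QB; rewrite setIC (zeta_indep QB SA) muleC. Qed.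

Section kernel.
Variable Phi : U -> 'rV[R]_m -> R.
Hypothesis Phi_meas : measurable_on (borel_prod U 'rV[R]_m) (V `*` Xi)
  (fun z => Phi z.1 z.2).

(** Moment bounds are available on [V] only. The value 0 elsewhere makes them hold for every [w],
    and changes nothing along a path that stays in [V]. *)
Let k n (w w' : Omega) : R :=
  if `[< V (u n w) >] then Phi (u n w) (zeta n w') else 0.

Let Phi_borel (Y : set R) : measurable Y -> exists2 B, borel_prod U 'rV[R]_m B &
  (V `*` Xi) `&` (fun z => Phi z.1 z.2) @^-1` Y = (V `*` Xi) `&` B.
Proof.
move=> mY; apply: (measurable_on_measurable _ Phi_meas mY).
exact: smallest_sigma_algebra.
Qed.

Let pre_sample (f : Omega -> 'rV[R]_m) (v : U) (A : set R) B : (forall w, Xi (f w)) ->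
  V v -> (V `*` Xi) `&` (fun z => Phi z.1 z.2) @^-1` A = (V `*` Xi) `&` B ->
  (fun w => Phi v (f w)) @^-1` A = f @^-1` [set x | B (v, x)].
Proof.
move=> fXi Vv e; apply/seteqP; split => w /= h.
  have : ((V `*` Xi) `&` (fun z => Phi z.1 z.2) @^-1` A) (v, f w).
    by split; [split; [exact: Vv | exact: fXi] | exact: h].
  by rewrite e => -[].
have : ((V `*` Xi) `&` B) (v, f w).
  by split; [split; [exact: Vv | exact: fXi] | exact: h].
by rewrite -e => -[].
Qed.

Lemma measurable_Phi (f : Omega -> 'rV[R]_m) v : measurable_wrt measurable f ->
  (forall w, Xi (f w)) -> V v -> measurable_fun [set: Omega] (fun w => Phi v (f w)).
Proof.
move=> mf fXi Vv _ A mA; rewrite setTI; have [B bB e] := Phi_borel mA.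
rewrite (pre_sample fXi Vv e).
by apply: (measurable_sample mf); exact: borel_prod_section.
Qed.

Let law n v : V v -> forall A : set R, measurable A ->
  P ((fun w => Phi v (zeta n w)) @^-1` A) = P ((fun w => Phi v (xi w)) @^-1` A).
Proof.
move=> Vv A mA; have [B bB e] := Phi_borel mA.
rewrite (pre_sample (@zeta_Xi n) Vv e) (pre_sample xi_Xi Vv e).
by apply: zeta_distr; exact: borel_prod_section.
Qed.

Let k_meas : kernel_measurable S Q k.
Proof.
move=> n _ Y mY; rewrite setTI; have [B bB e] := Phi_borel mY.
pose T1 := g_sigma_algebraType (S n); pose T2 := g_sigma_algebraType (Q n).
have uS (O : set U) : open O -> measurable (u n @^-1` O : set T1).
  by move=> oO; apply: sub_sigma_algebra; left; exact: u_adapted.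
have mg : measurable ((fun z : T1 * T2 => (u n z.1, zeta n z.2)) @^-1` B).
  move: bB; apply: preimage_generated; first exact: sigma_algebra_measurable.
  move=> _ [A oA [A' oA' <-]].
  rewrite (_ : _ @^-1` _ = (u n @^-1` A : set T1) `*` (zeta n @^-1` A' : set T2)) //.
  apply: measurableX; first exact: uS.
  by apply: sub_sigma_algebra; exists A' => //; exact: sub_sigma_algebra.
have mV : measurable ((u n @^-1` V : set T1) `*` (setT : set T2)).
  by apply: measurableX => //; exact: uS.
(* Over [V] the inverse image is that of the witness [B]; off [V] the kernel is 0, so it is
   everything or nothing according to whether 0 lies in [Y]. *)
rewrite (_ : _ @^-1` Y = (((u n @^-1` V : set T1) `*` (setT : set T2)) `&`
    ((fun z : T1 * T2 => (u n z.1, zeta n z.2)) @^-1` B)) `|`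
    (~` ((u n @^-1` V : set T1) `*` (setT : set T2)) `&` [set _ | Y 0])); last first.
  apply/seteqP; split => -[w w'] /=; rewrite /k /=; case: asboolP => Vw.
  - move=> h; left; split => //.
    have : ((V `*` Xi) `&` (fun z => Phi z.1 z.2) @^-1` Y) (u n w, zeta n w').
      by split; [split; [exact: Vw | exact: zeta_Xi] | exact: h].
    by rewrite e => -[].
  - by move=> Y0; right; split => // -[].
  - move=> [[_ Bw]|[]]; last by move=> /not_andP[].
    have : ((V `*` Xi) `&` B) (u n w, zeta n w').
      by split; [split; [exact: Vw | exact: zeta_Xi] | exact: Bw].
    by rewrite -e => -[].
  - by move=> [[[]]|[]].
apply: measurableU; first exact: measurableI.
apply: measurableI; first exact: measurableC.
have [Y0|nY0] := pselect (Y 0).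
  by rewrite (_ : [set _ | _] = setT) //; apply/seteqP; split.
by rewrite (_ : [set _ | _] = set0) //; apply/seteqP; split.
Qed.

Let k_sqr c : 0 <= c ->
  (forall v, V v -> \int[P]_w (Phi v (xi w) ^+ 2)%:E <= c%:E)%E ->
  forall n w, (\int[P]_w' (k n w w' ^+ 2)%:E <= c%:E)%E.
Proof.
move=> c0 hc n w; rewrite /k; case: asboolP => Vw; last first.
  by under eq_integral do rewrite expr0n; rewrite integral0 lee_fin.
have := @eq_law_ge0 _ _ _ P _ _ (measurable_Phi (@zeta_meas n) (@zeta_Xi n) Vw)
  (measurable_Phi xi_meas xi_Xi Vw) (law n Vw) (fun x => (x ^+ 2)%:E).
move=> ->; first exact: hc.
  by apply/measurable_EFinP; exact: measurable_funX.
by move=> x; rewrite lee_fin sqr_ge0.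
Qed.

(** Since [zeta n] and [xi] have the same law, the mean over the fresh sample at a frozen iterate is
    [phi] of that iterate. *)
Lemma sample_noise_cvg (t : nat -> R) (c : R) (phi : U -> R) : 0 <= c ->
  (forall v, V v -> \int[P]_w (Phi v (xi w) ^+ 2)%:E <= c%:E)%E ->
  (forall v, V v -> phi v = fine (\int[P]_w (Phi v (xi w))%:E)%E) ->
  cvgn (series (fun n => t n ^+ 2)) ->
  {ae P, forall w, (forall n, V (u n w)) -> cvgn (series (fun n =>
     t n * (Phi (u n w) (zeta n w) - phi (u n w))))}.
Proof.
move=> c0 hc hphi ct.
have := @noise_cvg _ _ _ P S Q S_meas S_mono QS SQ_indep k t c k_meas (k_sqr c0 hc) ct.
apply: filterS => w cw Vw.
suff -> : (fun n => t n * (Phi (u n w) (zeta n w) - phi (u n w))) =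
  (fun n => t n * (k n w w - fine (\int[P]_w' (k n w w')%:E)%E)) by [].
apply/funext => n; rewrite /k asboolT // hphi //; congr (_ * (_ - fine _)).
symmetry; exact: (@eq_law_integral _ _ _ P _ _ (measurable_Phi (@zeta_meas n) (@zeta_Xi n) (Vw n))
  (measurable_Phi xi_meas xi_Xi (Vw n)) (law n (Vw n))).
Qed.

Lemma sample_sqr_cvg (t : nat -> R) (c : R) : 0 <= c ->
  (forall v, V v -> \int[P]_w (Phi v (xi w) ^+ 2)%:E <= c%:E)%E ->
  cvgn (series (fun n => t n ^+ 2)) ->
  {ae P, forall w, (forall n, V (u n w)) -> cvgn (series (fun n =>
     (t n * Phi (u n w) (zeta n w)) ^+ 2))}.
Proof.
move=> c0 hc ct.
have := @diag_sqr_cvg _ _ _ P S Q S_meas S_mono QS SQ_indep k t c k_meas (k_sqr c0 hc) ct.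
apply: filterS => w cw Vw.
suff -> : (fun n => (t n * Phi (u n w) (zeta n w)) ^+ 2) =
  (fun n => (t n * k n w w) ^+ 2) by [].
by apply/funext => n; rewrite /k asboolT.
Qed.

End kernel.
End samples.

(** * The stochastic gradient method *)

Section descent_along_paths.
Context {R : realType} {E : tvsType R} {U : topologicalType}.
Variable M : riemannian E U.
Hypothesis Hlog : log_exists M.
Hypothesis inj_gt0 : (0 < inj_radius M)%E.
Variables (V : set U) (j : U -> R) (L : R).
Hypothesis j_lip : lipschitz_diff M V j L.

(** The terms of a convergent series tend to 0, so from some index on the estimates along short
    geodesics become available. *)
Lemma eventually_short (u : nat -> U) (v : nat -> E) :
  cvgn (series (fun n => tnorm M (u n) (v n) ^+ 2)) ->
  \forall n \near \oo, ((tnorm M (u n) (v n))%:E < inj_radius M)%E.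
Proof.
have [r r0 ri] := radius_below_inj inj_gt0.
move=> /cvg_series_cvg_0 c0.
have : \forall n \near \oo, tnorm M (u n) (v n) ^+ 2 < r ^+ 2.
  have : \forall z \near (0 : R), z < r ^+ 2 by apply: lt_nbhsl; rewrite exprn_gt0.
  exact: c0.
apply: filterS => n; rewrite ltr_pXn2r ?nnegrE ?tnorm_ge0 ?(ltW r0) //= => h.
by apply: lt_le_trans ri; rewrite lte_fin.
Qed.

Lemma path_descent (t x y : nat -> R) (u : nat -> U) (X : nat -> E) :
  (forall n, x n = tnorm M (u n) (X n)) ->
  (forall n, y n = G M (u n) (grad M j (u n)) (X n)) ->
  cvgn (series (fun n => (t n * x n) ^+ 2)) ->
  (\forall n \near \oo, exp_in M V (u n) (- (t n *: X n)) (u n.+1)) ->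
  \forall n \near \oo, j (u n.+1) <= j (u n) - t n * y n + L / 2 * (t n * x n) ^+ 2.
Proof.
move=> xE yE ct ev.
have tE n : tnorm M (u n) (- (t n *: X n)) ^+ 2 = (t n * x n) ^+ 2.
  by rewrite tnormN tnormZ !exprMn xE real_normK ?num_real.
have sh : \forall n \near \oo, ((tnorm M (u n) (- (t n *: X n)))%:E < inj_radius M)%E.
  apply: eventually_short.
  by rewrite (_ : (fun n => _) = fun n => (t n * x n) ^+ 2) //; apply/funext.
apply: filterS2 ev sh => n en sn; have := descent Hlog j_lip en sn.
by rewrite tE GNr GZr -yE.
Qed.

Lemma path_grad_step (t x : nat -> R) (u : nat -> U) (X : nat -> E) :
  (forall n, 0 <= t n) -> (forall n, x n = tnorm M (u n) (X n)) ->
  (forall n, V (u n)) ->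
  (forall n, is_exp M (u n) (- (t n *: X n)) (u n.+1)) ->
  cvgn (series (fun n => (t n * x n) ^+ 2)) ->
  \forall n \near \oo, tnorm M (u n.+1) (grad M j (u n.+1)) -
    tnorm M (u n) (grad M j (u n)) <= L * (t n * x n).
Proof.
move=> t0 xE Vu ue ct.
have tE n : tnorm M (u n) (- (t n *: X n)) = t n * x n.
  by rewrite tnormN tnormZ xE ger0_norm.
have sh : \forall n \near \oo, ((tnorm M (u n) (- (t n *: X n)))%:E < inj_radius M)%E.
  apply: eventually_short.
  rewrite (_ : (fun n => _) = fun n => (t n * x n) ^+ 2) //.
  by apply/funext => n; rewrite tE.
apply: filterS sh => n sn.
have := grad_norm_lipschitz Hlog j_lip (ue n) (Vu n) (Vu n.+1) sn.
by rewrite tE; apply: le_trans; exact: ler_norm.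
Qed.

End descent_along_paths.

Theorem theorem2
  (R : realType) (E : tvsType R) (U : topologicalType) (M : riemannian E U)
  (Uconn : connected [set: U])
  (d : measure_display) (Omega : measurableType d) (P : probability Omega R)
  (m : nat) (Xi : set 'rV[R]_m) (xi : Omega -> 'rV[R]_m)
  (xi_meas : measurable_wrt measurable xi) (xi_Xi : forall w, Xi (xi w))
  (J : U -> 'rV[R]_m -> R)
  (J_int : forall u, P.-integrable setT (fun w => (J u (xi w))%:E))
  (HM : assumptionM M P xi J) (Hlog : log_exists M)
  (t : nat -> R) (t_ge0 : forall n, 0 <= t n)
  (t_sum : (\sum_(0 <= n <oo) (t n)%:E = +oo)%E)
  (t_sum2 : (\sum_(0 <= n <oo) (t n ^+ 2)%:E < +oo)%E)
  (gJ : U -> 'rV[R]_m -> E)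
  (zeta : nat -> Omega -> 'rV[R]_m) (F : nat -> set (set Omega))
  (u1 : U) (u : nat -> Omega -> U)
  (zeta_meas : forall n, measurable_wrt measurable (zeta n))
  (zeta_Xi : forall n w, Xi (zeta n w))
  (zeta_distr : forall n B, borel 'rV[R]_m B ->
     P (zeta n @^-1` B) = P (xi @^-1` B))
  (F_filt : filtration F)
  (zeta_indep : forall n, indep_sigma P (sigma_of (zeta n)) (past F zeta n))
  (u_init : forall w, u 0%N w = u1)
  (u_step : forall n w,
     is_exp M (u n w) (- (t n *: gJ (u n w) (zeta n w))) (u n.+1 w))
  (u_adapted : forall n, measurable_wrt (F n) (u n))
  (C V : set U) (C_bounded : bounded M C)
  (u_C : {ae P, forall w, forall n, C (u n w)})
  (V_open : open V) (C_V : C `<=` V)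
  (u_V : {ae P, forall w, \forall n \near \oo,
     exp_in M V (u n w) (- (t n *: gJ (u n w) (zeta n w))) (u n.+1 w)})
  (L : R) (j_lip : lipschitz_diff M V (expected P xi J) L)
  (j_low : exists b : R, forall v, V v -> b <= expected P xi J v)
  (gJ_sg : stochastic_gradient M P Xi xi V J gJ)
  (K : R) (K_ge0 : 0 <= K)
  (gJ_bound : forall v, V v ->
     (\int[P]_w ((tnorm M v (gJ v (xi w))) ^+ 2)%:E <= K%:E)%E) :
  let j := expected P xi J in
  {ae P, forall w, cvgn (fun n => j (u n w)) /\
     limn_einf (fun n => (tnorm M (u n w) (grad M j (u n w)))%:E) = 0%E} /\
  (forall Lf : R, lipschitz_diff M V (fun v => tnorm M v (grad M j v) ^+ 2) Lf ->
     {ae P, forall w,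
        tnorm M (u n w) (grad M j (u n w)) @[n --> \oo] --> (0 : R)} /\
     {ae P, forall w, forall v, V v -> cluster (u n w @[n --> \oo]) v ->
        grad M j v = 0}).
Proof.
move=> j.
have [_ _ inj0 _] := HM.
have [Lgt0 j_grad _] := j_lip.
have [meas1 meas2] := gJ_sg.1.
have {}meas2 := meas2 j j_grad.
have ct2 : cvgn (series (fun n => t n ^+ 2)).
  by apply: nneseries_cvgn => // n; exact: sqr_ge0.
have ct : ~ cvgn (series t).
  by move=> /(cvgn_nneseries t_ge0); rewrite t_sum ltxx.
pose x1 (v : U) z := tnorm M v (gJ v z).
pose y1 (v : U) z := G M v (grad M j v) (gJ v z).
have mx v : V v -> measurable_fun [set: Omega] (fun w => x1 v (xi w)).
  exact: (measurable_Phi meas1 xi_meas xi_Xi).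
have my v : V v -> measurable_fun [set: Omega] (fun w => y1 v (xi w)).
  exact: (measurable_Phi meas2 xi_meas xi_Xi).
(* The weak mean of the stochastic gradient is tested against [grad M j v] itself. *)
have ymean v : V v -> tnorm M v (grad M j v) ^+ 2 = fine (\int[P]_w (y1 v (xi w))%:E)%E.
  move=> Vv; have [_ _ _ /(_ (grad M j v)) [_ e]] := gJ_sg.2 v Vv.
  rewrite tnorm_sqr -[LHS]/(fine (_)%:E) -e; congr fine.
  by apply: eq_integral => w _; rewrite /y1 G_sym.
have ysqr v : V v ->
    (\int[P]_w (y1 v (xi w) ^+ 2)%:E <= (tnorm M v (grad M j v) ^+ 2 * K)%:E)%E.
  move=> Vv; rewrite EFinM.
  apply: (@le_trans _ _ ((tnorm M v (grad M j v) ^+ 2)%:E *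
     \int[P]_w (x1 v (xi w) ^+ 2)%:E)%E); last first.
    by apply: lee_wpmul2l; [rewrite lee_fin sqr_ge0 | exact: gJ_bound].
  rewrite -ge0_integralZl //; last 3 first.
  - by apply/measurable_EFinP; apply: measurable_funX; exact: mx.
  - by move=> w _; rewrite lee_fin sqr_ge0.
  - by rewrite lee_fin sqr_ge0.
  apply: ge0_le_integral => //.
  - by move=> w _; rewrite lee_fin sqr_ge0.
  - by apply/measurable_EFinP; apply: measurable_funX; exact: my.
  - apply/measurable_EFinP; apply: measurable_funM => //.
    by apply: measurable_funX; exact: mx.
  move=> w _; rewrite -EFinM lee_fin -exprMn -[leLHS]real_normK ?num_real //.
  by rewrite lerXn2r ?nnegrE ?mulr_ge0 ?tnorm_ge0 // tnorm_cauchy.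
(* The squared mean of [y1] gives [|grad j|^4 <= |grad j|^2 * K]; a factor cancels unless the
   gradient vanishes. *)
have grad_le v : V v -> tnorm M v (grad M j v) ^+ 2 <= K.
  move=> Vv; have := mean_sqr_le (my v Vv) (ysqr v Vv).
  rewrite -ymean // expr2; have [->|g0] := eqVneq (tnorm M v (grad M j v) ^+ 2) 0.
    by [].
  by rewrite ler_pM2l // lt_neqAle eq_sym g0 sqr_ge0.
have ysqrK v : V v -> (\int[P]_w (y1 v (xi w) ^+ 2)%:E <= (K * K)%:E)%E.
  move=> Vv; apply: (le_trans (ysqr v Vv)); rewrite lee_fin.
  by rewrite ler_wpM2r // grad_le.
(* The mean length of the sampled gradient at [v]; by Jensen it is at most [Num.sqrt K], uniformly
   in [v]. *)
pose a v := fine (\int[P]_w (x1 v (xi w))%:E)%E.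
have a_le v : V v -> a v <= Num.sqrt K.
  move=> Vv; apply: (le_trans (ler_norm _)); rewrite -sqrtr_sqr ler_sqrt //.
  exact: mean_sqr_le (mx v Vv) (gJ_bound v Vv).
have Hx : {ae P, forall w, (forall n, V (u n w)) -> cvgn (series (fun n =>
     t n * (x1 (u n w) (zeta n w) - a (u n w))))}.
  exact: (sample_noise_cvg xi_meas xi_Xi zeta_meas zeta_Xi zeta_distr F_filt
    zeta_indep u_adapted V_open meas1 K_ge0 gJ_bound (fun _ _ => erefl) ct2).
have Hq : {ae P, forall w, (forall n, V (u n w)) -> cvgn (series (fun n =>
     (t n * x1 (u n w) (zeta n w)) ^+ 2))}.
  exact: (sample_sqr_cvg xi_meas xi_Xi zeta_meas zeta_Xi zeta_distr F_filt
    zeta_indep u_adapted V_open meas1 K_ge0 gJ_bound ct2).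
have Hy : {ae P, forall w, (forall n, V (u n w)) -> cvgn (series (fun n =>
     t n * (y1 (u n w) (zeta n w) - tnorm M (u n w) (grad M j (u n w)) ^+ 2)))}.
  exact: (sample_noise_cvg (phi := fun v => tnorm M v (grad M j v) ^+ 2)
    xi_meas xi_Xi zeta_meas zeta_Xi zeta_distr F_filt
    zeta_indep u_adapted V_open meas2 (mulr_ge0 K_ge0 K_ge0) ysqrK ymean ct2).
have uV : {ae P, forall w, forall n, V (u n w)}.
  by apply: filterS u_C => w Cw n; exact: C_V.
have [b jb] := j_low.
(* Outside the exceptional null sets, the descent argument is carried out on a single path. *)
have core : {ae P, forall w, [/\ forall n, V (u n w),
    cvgn (series (fun n => (t n * x1 (u n w) (zeta n w)) ^+ 2)),
    cvgn (fun n => j (u n w)) &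
    cvgn (series (fun n => t n * tnorm M (u n w) (grad M j (u n w)) ^+ 2))]}.
  apply: filterS2 (filterI Hq Hy) (filterI uV u_V) => w [hq hy] [Vw ew].
  have {}hq := hq Vw; have {}hy := hy Vw.
  have dsc := path_descent Hlog inj0 j_lip (fun n => erefl _)
    (fun n => erefl _) hq ew.
  have [] := descent_cvg t_ge0 (fun n => jb _ (Vw n)) hy hq dsc.
  by split.
have small w e N : (forall n, V (u n w)) ->
    cvgn (series (fun n => t n * tnorm M (u n w) (grad M j (u n w)) ^+ 2)) ->
    0 < e -> exists2 n, (N <= n)%N & tnorm M (u n w) (grad M j (u n w)) < e.
  move=> Vw ctg; apply: (frequently_small t_ge0 _ ct ctg).
  by move=> n; exact: tnorm_ge0.
have lim0 : {ae P, forall w,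
    tnorm M (u n w) (grad M j (u n w)) @[n --> \oo] --> (0 : R)}.
  apply: filterS2 core Hx => w [Vw hq _ ctg] hx.
  have step := path_grad_step Hlog inj0 j_lip t_ge0 (fun n => erefl _) Vw
    (u_step ^~ w) hq.
  (* The travelled lengths are [t n] times the norms of the sampled gradients; their centering [a]
     is bounded by [Num.sqrt K]. *)
  apply: (excursion_cvg Lgt0 (sqrtr_ge0 K) t_ge0 _ _ _ _ ctg (hx Vw) step).
  - by move=> n; exact: tnorm_ge0.
  - by move=> n; exact: a_le.
  - by move=> e N; exact: small.
  (* The step sizes tend to 0 because their squares are summable. *)
  apply/cvgrPdist_lt => e e0.
  have : \forall n \near \oo, t n ^+ 2 < e ^+ 2.
    have : \forall z \near (0 : R), z < e ^+ 2 by apply: lt_nbhsl; rewrite exprn_gt0.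
    exact: (cvg_series_cvg_0 ct2).
  apply: filterS => n; rewrite sub0r normrN ger0_norm //.
  by rewrite ltr_pXn2r ?nnegrE ?(ltW e0).
split.
  apply: filterS core => w [Vw _ cj ctg]; split => //.
  apply: limn_einf_eq0 => [n|e N]; first exact: tnorm_ge0.
  exact: small.
move=> Lf _; split => //.
apply: filterS2 lim0 uV => w l0 Vw v Vv.
exact: (cluster_stationary Hlog inj0 j_lip Vw Vv l0).
Qed.
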